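(* Let $k\ge1$ be fixed and let $L>0$. There is a constant $C>0$ depending only on $k$ and $L$ such that the following holds. For each $n\ge k$, let $A_n$ be a fixed (deterministic) $n\times n$ Hermitian matrix with spectrum contained in $[-L,L]$, let $U_n$ be Haar-distributed in $\mathbb{U}(n)$ (all $U_n$ defined on a common probability space), let $M_n=P_kU_nA_nU_n^*P_k^*$, and let $\mu_n=\mathbb{E}\mu_{M_n}$. Then with probability $1$, $$d_1(\mu_{M_n},\mu_n)\le Cn^{-1/3}$$ for all sufficiently large $n$.
   Context: $\mathbb{U}(n)$ is the unitary group. $P_k$ is the projection onto the span of the first $k$ standard basis vectors, regarded as the $k\times n$ matrix $[I_k\ 0]$, so that $P_kBP_k^*$ is the upper-left $k\times k$ submatrix of an $n\times n$ matrix $B$. For an $N\times N$ normal matrix $B$ with eigenvalues $\lambda_1,\dots,\lambda_N$ (with multiplicity), $\mu_B=\frac1N\sum_{i=1}^N\delta_{\lambda_i}$. $\mathbb{E}\mu_{M_n}$ is the mean measure, $(\mathbb{E}\mu_{M_n})(S)=\mathbb{E}[\mu_{M_n}(S)]$. $d_1$ is the $L_1$ Wasserstein distance, $d_1(\mu,\rho)=\inf_\pi\int|x-y|\,d\pi(x,y)$, the infimum over couplings $\pi$ of $\mu$ and $\rho$. No assumption is made on the joint distribution of the $U_n$. *)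

(* Defs.v *)
From HB Require Import structures.
From mathcomp Require Import all_boot all_order all_algebra.
From mathcomp Require Import all_classical all_reals all_analysis.
From mathcomp Require Import complex spectral.

Set Implicit Arguments.
Unset Strict Implicit.
Unset Printing Implicit Defensive.

Import Order.TTheory GRing.Theory Num.Theory.
Import numFieldTopology.Exports numFieldNormedType.Exports.

Local Open Scope classical_set_scope.
Local Open Scope ring_scope.
Local Open Scope complex_scope.
Local Open Scope sesquilinear_scope.

(* R[i]^o carries the topology induced by the modulus. *)
HB.instance Definition _ (R : realType) := PseudoMetric.copy R[i] R[i]^o.
HB.instance Definition _ (R : realType) := Pointed.copy R[i] R[i]^o.

Notation borel T := (g_sigma_algebraType (@open T)).

Section Eigenvalues.
Variable (R : realType).

(* The roots of the characteristic polynomial, so each eigenvalue is repeated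
   according to its multiplicity. *)
Definition eigenvals (N : nat) (B : 'M[R[i]]_N) : seq R[i] :=
  sval (closed_field_poly_normal (char_poly B)).

Lemma char_poly_eigenvals (N : nat) (B : 'M[R[i]]_N) :
  char_poly B = \prod_(z <- eigenvals B) ('X - z%:P).
Proof.
rewrite /eigenvals; case: closed_field_poly_normal => s /= {1}->.
by rewrite (monicP (char_poly_monic B)) scale1r.
Qed.

Lemma size_eigenvals (N : nat) (B : 'M[R[i]]_N) : size (eigenvals B) = N.
Proof.
by apply: succn_inj; rewrite -(size_char_poly B) char_poly_eigenvals
  size_prod_XsubC.
Qed.

Definition spectral_measure (N : nat) (B : 'M[R[i]]_N) :
    set (borel R[i]) -> \bar R :=
  fun S => ((N%:R^-1)%:E * \sum_(z <- eigenvals B) \d_(z : borel R[i]) S)%E.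

End Eigenvalues.

(* Only a set function: that it is a probability measure depends on the
   measurability in w of M w S. *)
Definition mean_measure (R : realType) (d : measure_display)
    (Omega : measurableType d) (P : probability Omega R) (T : Type)
    (M : Omega -> set T -> \bar R) : set T -> \bar R :=
  fun S => (\int[P]_w M w S)%E.

Section Wasserstein.
Variable (R : realType).

Definition coupling (mu rho : set (borel R[i]) -> \bar R)
    (pi : probability (borel R[i] * borel R[i])%type R) : Prop :=
  forall S : set (borel R[i]), measurable S ->
    pi (S `*` setT) = mu S /\ pi (setT `*` S) = rho S.

(* The infimum of the empty set is +oo, so d1 mu rho is finite only if mu and
   rho agree with probability measures on Borel sets. *)
Definition d1 (mu rho : set (borel R[i]) -> \bar R) : \bar R :=
  ereal_inf [set (\int[pi]_p (Normc.normc (p.1 - p.2))%:E)%E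
            | pi in coupling mu rho].

End Wasserstein.

(* U is a random element of the unitary group and V U, U V have the law of U
   for every fixed unitary V: as the group is compact, its Haar probability
   measure is the translation-invariant one. *)
Definition haar_distributed (R : realType) (d : measure_display)
    (Omega : measurableType d) (P : probability Omega R) (n : nat)
    (U : Omega -> 'M[R[i]]_n) : Prop :=
  [/\ measurable_fun setT (U : Omega -> borel 'M[R[i]]_n),
      forall w, U w \is unitarymx,
      forall (V : 'M[R[i]]_n) (S : set (borel 'M[R[i]]_n)),
        V \is unitarymx -> measurable S ->
        P [set w | S (V *m U w)] = P [set w | S (U w)]
    & forall (V : 'M[R[i]]_n) (S : set (borel 'M[R[i]]_n)),
        V \is unitarymx -> measurable S ->
        P [set w | S (U w *m V)] = P [set w | S (U w)]].

(* pid_mx k is the k x n block matrix [I_k 0] when k <= n. *)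
Definition compression (R : realType) (k n : nat) (U A : 'M[R[i]]_n) :
    'M[R[i]]_k :=
  let Pk : 'M[R[i]]_(k, n) := pid_mx k in
  Pk *m U *m A *m U^t* *m Pk^t*.

(* Main.v *)
From HB Require Import structures.
Require Import Defs.
From mathcomp Require Import all_boot all_order all_algebra.
From mathcomp Require Import all_classical all_reals all_analysis.
From mathcomp Require Import complex spectral.
From mathcomp Require Import cyclic separable cyclotomic.
From mathcomp Require Import measurable_realfun.
From mathcomp Require Import ring lra zify.

(** Put m = tr A / n. For fixed k the compression of U A U^* is close to m I,
    so both the spectral measure of M and its mean are close to the point mass
    at m, and only the speed of this concentration is at stake: it is enough
    that the entries of M - m I have eighth moments of order n^(-4). Indeed,
    let D be the squared Frobenius norm of M - m I, that is the sum of the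
    squared distances of the eigenvalues of M to m. Then E D^4 = O(n^(-4)), so
    E [D^4 / n^(-8/3)] = O(n^(-4/3)) is summable in n, and therefore almost
    surely D <= n^(-2/3) for all large n, whatever the joint law of the U_n.
    On that event every eigenvalue of M is within n^(-1/3) of m; in mean the
    distance of an eigenvalue to m is also O(n^(-1/3)). Pairing the eigenvalues
    at the given sample point with those at a random one therefore costs
    O(n^(-1/3)).

    The eighth moments come from the invariance of U under U -> U V alone.
    Let W be unitary such that B = W (A - m I) W^* has zero diagonal; such a W
    is the discrete Fourier transform composed with a diagonalization of A,
    because all entries of the Fourier matrix have modulus n^(-1/2). As U and
    U W^* have the same law, an entry of M - m I has the law of
    sum_(a, b) U_ia B_ab conj(U_jb). Multiplying the columns of U by signs does
    not change its law either, and in independent signs this sum is a quadratic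
    form without diagonal terms. Bonami's hypercontractive inequality bounds
    its eighth moment by the fourth power of its second moment, and the latter
    is controlled by the Frobenius norm of B and by E |U_ia|^16. The same trick
    gives E |U_ia|^16 = O(n^(-8)): after multiplication by random signs and the
    Fourier matrix, an entry of U becomes a Rademacher sum of variance 1/n.

    The mean measure is a measure only if the spectral measure of every Borel
    set is a measurable function of the sample. The power sums of the
    eigenvalues are traces of powers of M, hence measurable, and the largest
    term of a finite family is determined by countably many inequalities
    between power sums; removing it and iterating yields a measurable
    enumeration of the eigenvalues (measurable_enumeration). This enumeration
    also provides the coupling, as a mean of image measures of P. *)


Set Implicit Arguments.
Unset Strict Implicit.
Unset Printing Implicit Defensive.

Import Order.TTheory GRing.Theory Num.Theory.
Import numFieldTopology.Exports numFieldNormedType.Exports.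

Local Open Scope classical_set_scope.
Local Open Scope ring_scope.
Local Open Scope complex_scope.
Local Open Scope sesquilinear_scope.

(** * Rademacher chaos and hypercontractivity *)

Section Rademacher.
Variable R : realFieldType.
Implicit Types (f g h : seq R -> R) (n d : nat).

(** The expectation of f over n independent uniform signs. The recursion is on
    the first sign, so that it matches the decomposition g + e h used by
    [chaos]. *)
Fixpoint rad n f : R :=
  if n is m.+1 then
    (rad m (fun s => f (1 :: s)) + rad m (fun s => f (- 1 :: s))) / 2
  else f [::].

(** Multilinear polynomials of degree at most d in n signs, up to their values
    outside the cube: f = g + e h, where e is the first sign, with g of degree
    at most d and h of degree at most d - 1 in the others. The equation is only
    required when e ^+ 2 = 1, so that the class is closed under products
    ([chaosM]). *)
Fixpoint chaos n d f : Prop :=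
  if n is m.+1 then exists g h,
    [/\ chaos m d g, if d is d'.+1 then chaos m d' h else h = cst 0 &
        forall e s, e ^+ 2 = 1 -> f (e :: s) = g s + e * h s]
  else True.

Lemma radD n f g : rad n (fun s => f s + g s) = rad n f + rad n g.
Proof. by elim: n f g => //= n IH f g; rewrite !IH; ring. Qed.

Lemma radZ n a f : rad n (fun s => a * f s) = a * rad n f.
Proof. by elim: n f => //= n IH f; rewrite !IH; ring. Qed.

Lemma rad_cst n a : rad n (fun=> a) = a.
Proof. by elim: n => //= n ->; field. Qed.

Lemma rad_ge0 n f : (forall s, 0 <= f s) -> 0 <= rad n f.
Proof.
elim: n f => //= n IH f f0; rewrite divr_ge0// addr_ge0//; exact: IH.
Qed.

Lemma rad_le n f g : (forall s, f s <= g s) -> rad n f <= rad n g.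
Proof.
move=> fg; rewrite -subr_ge0 -mulN1r -radZ -radD rad_ge0// => s.
by rewrite mulN1r subr_ge0.
Qed.

(** By induction: if a^2 <= A B and a'^2 <= A' B' then 2 a a' <= A B' + A' B by
    the arithmetic-geometric mean inequality. *)
Lemma rad_cauchy_schwarz n f g :
  rad n (fun s => f s * g s) ^+ 2 <=
  rad n (fun s => f s ^+ 2) * rad n (fun s => g s ^+ 2).
Proof.
elim: n f g => [|n IH] f g /=; first by rewrite -exprMn.
have := IH (fun s => f (1 :: s)) (fun s => g (1 :: s)).
have := IH (fun s => f (- 1 :: s)) (fun s => g (- 1 :: s)).
have := rad_ge0 n (fun s => sqr_ge0 (f (1 :: s))).
have := rad_ge0 n (fun s => sqr_ge0 (f (- 1 :: s))).
have := rad_ge0 n (fun s => sqr_ge0 (g (1 :: s))).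
have := rad_ge0 n (fun s => sqr_ge0 (g (- 1 :: s))).
set a := rad n _; set b := rad n _; set c := rad n _; set e := rad n _.
set x := rad n _; set y := rad n _ => a0 b0 c0 e0 xca yeb.
have xy : 2 * (x * y) <= e * a + c * b.
  rewrite (le_trans (ler_norm _))// -(@ler_pXn2r _ 2) ?nnegrE//; last first.
    by rewrite addr_ge0// mulr_ge0.
  rewrite -normrX ger0_norm ?sqr_ge0//.
  have : x ^+ 2 * y ^+ 2 <= (c * a) * (e * b) by rewrite ler_pM ?sqr_ge0.
  have := sqr_ge0 (e * a - c * b); nra.
nra.
Qed.

Lemma chaos0 n d : chaos n d (cst 0).
Proof.
elim: n d => //= n IH d; exists (cst 0), (cst 0); split=> //.
  by case: d => //.
by move=> e s _; rewrite /= mulr0 addr0.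
Qed.

Lemma chaosS n d f : chaos n d f -> chaos n d.+1 f.
Proof.
elim: n d f => //= n IH d f [g [h [cg ch fE]]]; exists g, h; split=> //.
  exact: IH.
by case: d ch {cg} => [->|d]; [exact: chaos0|exact: IH].
Qed.

Lemma chaosD n d f g : chaos n d f -> chaos n d g ->
  chaos n d (fun s => f s + g s).
Proof.
elim: n d f g => //= n IH d f f' [g [h [cg ch fE]]] [g' [h' [cg' ch' fE']]].
exists (fun s => g s + g' s), (fun s => h s + h' s); split.
- exact: IH.
- case: d ch ch' {cg cg'} => [-> ->|d]; last exact: IH.
  by apply/funext => s /=; rewrite addr0.
- by move=> e s e1; rewrite fE// fE'//; ring.
Qed.

Lemma chaosM n d d' f f' : chaos n d f -> chaos n d' f' ->
  chaos n (d + d') (fun s => f s * f' s).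
Proof.
elim: n d d' f f' => //= n IH d d' f f'.
move=> [g [h [cg ch fE]]] [g' [h' [cg' ch' fE']]].
exists (fun s => g s * g' s + h s * h' s), (fun s => g s * h' s + h s * g' s).
split.
- apply: chaosD; first exact: IH.
  case: d d' ch ch' {cg cg'} => [|d] [|d'] ch ch'.
  1-3: rewrite (_ : (fun _ => _) = cst 0); first exact: chaos0.
  1-3: by apply/funext => s; rewrite ?ch ?ch' /= ?mul0r ?mulr0.
  by rewrite addSn addnS; apply/chaosS/chaosS/IH.
- case: d d' ch ch' cg cg' => [|d] [|d'] ch ch' cg cg'; rewrite ?addSn ?addnS.
  + by apply/funext => s; rewrite ch ch' /= mulr0 mul0r addr0.
  + rewrite (_ : (fun _ => _) = (fun s => g s * h' s)); first exact: (IH 0%N).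
    by apply/funext => s; rewrite ch /= mul0r addr0.
  + rewrite (_ : (fun _ => _) = (fun s => h s * g' s)); first exact: IH.
    by apply/funext => s; rewrite ch' /= mulr0 add0r.
  + apply: chaosD; first by rewrite -addSn; exact: IH.
    by rewrite -addnS; exact: IH.
- move=> e s e1; rewrite fE// fE'//.
  have -> : h s * h' s = e ^+ 2 * (h s * h' s) by rewrite e1 mul1r.
  by ring.
Qed.

(** Bonami's hypercontractive inequality. Averaging (g + e h)^4 over the sign e
    leaves g^4 + 6 g^2 h^2 + h^4; the Cauchy-Schwarz inequality and the
    induction hypotheses, with the factor 9^(d - 1) for h, bound the middle
    term by 2 * 9^d (E g^2) (E h^2), which completes the square. *)
Lemma bonami n d f : chaos n d f ->
  rad n (fun s => f s ^+ 4) <= 9 ^+ d * rad n (fun s => f s ^+ 2) ^+ 2.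
Proof.
elim: n d f => [d f _|n IH d f [g [h [cg ch fE]]]].
  rewrite /= -exprM ler_peMl ?exprn_even_ge0// exprn_ege1//; lra.
have fp s : f (1 :: s) = g s + h s by rewrite fE ?expr1n// mul1r.
have fm s : f (- 1 :: s) = g s - h s by rewrite fE ?sqrrN ?expr1n// mulN1r.
have -> : rad n.+1 (fun s => f s ^+ 4) = rad n (fun s => g s ^+ 4) +
    6 * rad n (fun s => g s ^+ 2 * h s ^+ 2) + rad n (fun s => h s ^+ 4).
  rewrite -radZ -!radD /= -radD mulrC -radZ; congr rad; apply/funext => s.
  by rewrite fp fm; field.
have -> : rad n.+1 (fun s => f s ^+ 2) =
    rad n (fun s => g s ^+ 2) + rad n (fun s => h s ^+ 2).
  rewrite /= -!radD mulrC -radZ; congr rad; apply/funext => s.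
  by rewrite fp fm; field.
have := rad_cauchy_schwarz n (fun s => g s ^+ 2) (fun s => h s ^+ 2).
have sq2 f' : (fun s : seq R => (f' s ^+ 2) ^+ 2) = (fun s => f' s ^+ 4).
  by apply/funext => s; rewrite -exprM.
rewrite !sq2.
have := IH _ _ cg; rewrite /=.
have := rad_ge0 n (fun s => sqr_ge0 (g s)).
have := rad_ge0 n (fun s => sqr_ge0 (h s)).
have := rad_ge0 n (fun s => mulr_ge0 (sqr_ge0 (g s)) (sqr_ge0 (h s))).
have : 0 <= rad n (fun s => h s ^+ 4).
  by apply: rad_ge0 => s; rewrite exprn_even_ge0.
have : 0 <= rad n (fun s => g s ^+ 4).
  by apply: rad_ge0 => s; rewrite exprn_even_ge0.
have h4 : rad n (fun s => h s ^+ 4) * 9 <= 9 ^+ d * rad n (fun s => h s ^+ 2) ^+ 2.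
  case: d ch {cg} => [->|d ch].
    have z m : (0 < m)%N -> rad n (fun s => cst 0 s ^+ m) = 0.
      move=> m0; rewrite -[RHS](rad_cst n); congr rad; apply/funext => s.
      by rewrite /= expr0n eqn0Ngt m0.
    by rewrite !z// expr0n mulr0 mul0r.
  by rewrite exprS -mulrA mulrC ler_pM2l// IH.
move: h4; set a := rad n _; set b := rad n _; set c := rad n _.
set x := rad n _; set e := rad n _ => h4 c0 a0 x0 b0 e0 c4 cs.
have K0 : 0 < 9 ^+ d :> R by rewrite exprn_gt0.
set K := 9 ^+ d in h4 c4 K0 *.
have Kx : 3 * x <= K * (e * b).
  rewrite -(@ler_pXn2r _ 2) ?nnegrE ?mulr_ge0 ?(ltW K0)//.
  have : c * (a * 9) <= K * e ^+ 2 * (K * b ^+ 2) by rewrite ler_pM// mulr_ge0.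
  have -> : (K * (e * b)) ^+ 2 = K * e ^+ 2 * (K * b ^+ 2) by ring.
  by move=> cae; rewrite (le_trans _ cae)// exprMn; lra.
have -> : K * (e + b) ^+ 2 = K * e ^+ 2 + 2 * (K * (e * b)) + K * b ^+ 2 by ring.
by have := mulr_ge0 (ltW K0) (sqr_ge0 b); lra.
Qed.

(** The square of a polynomial of degree d is a polynomial of degree 2 d, so
    [bonami] can be iterated. *)
Lemma radX8_le n d f : chaos n d f ->
  rad n (fun s => f s ^+ 8) <= 9 ^+ (d * 4) * rad n (fun s => f s ^+ 2) ^+ 4.
Proof.
move=> cf.
have := bonami (chaosM cf cf); have := bonami cf.
have sqX m : (fun s => (f s * f s) ^+ m) = (fun s => f s ^+ (2 * m)).
  by apply/funext => s; rewrite -expr2 -exprM.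
rewrite !sqX.
have : 0 <= rad n (fun s => f s ^+ 4).
  by apply: rad_ge0 => s; rewrite exprn_even_ge0.
set x := rad n _; set z := rad n _; set y := rad n _ => x0 xz yx.
rewrite (le_trans yx)// [9 ^+ (d * 4)](_ : _ = 9 ^+ (d + d) * 9 ^+ (d * 2)); last first.
  by rewrite -exprD; congr (_ ^+ _); lia.
rewrite -mulrA ler_pM2l ?exprn_gt0// (exprM _ d 2) [z ^+ 4](exprM z 2 2) -exprMn.
by rewrite ler_pXn2r// nnegrE mulr_ge0 ?sqr_ge0 ?exprn_ge0.
Qed.

Lemma radX16_le n d f : chaos n d f ->
  rad n (fun s => f s ^+ 16) <= 9 ^+ (d * 12) * rad n (fun s => f s ^+ 2) ^+ 8.
Proof.
move=> cf.
have := radX8_le (chaosM cf cf); have := bonami cf.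
have sqX m : (fun s => (f s * f s) ^+ m) = (fun s => f s ^+ (2 * m)).
  by apply/funext => s; rewrite -expr2 -exprM.
rewrite !sqX.
have : 0 <= rad n (fun s => f s ^+ 4).
  by apply: rad_ge0 => s; rewrite exprn_even_ge0.
set x := rad n _; set z := rad n _; set y := rad n _ => x0 xz yx.
rewrite (le_trans yx)// [9 ^+ (d * 12)](_ : _ = 9 ^+ ((d + d) * 4) * 9 ^+ (d * 4)); last first.
  by rewrite -exprD; congr (_ ^+ _); lia.
rewrite -mulrA ler_pM2l ?exprn_gt0//.
rewrite (exprM _ d 4) [z ^+ 8](exprM z 2 4) -exprMn.
by rewrite ler_pXn2r// nnegrE mulr_ge0 ?sqr_ge0 ?exprn_ge0.
Qed.

Definition linear_form n (x : 'I_n -> R) (s : seq R) := \sum_(i < n) s`_i * x i.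

Lemma linear_form_cons n (x : 'I_n.+1 -> R) e s :
  linear_form x (e :: s) = linear_form (x \o lift ord0) s + e * x ord0.
Proof. by rewrite /linear_form big_ord_recl /= addrC. Qed.

Lemma chaos_linear_form n (x : 'I_n -> R) : chaos n 1 (linear_form x).
Proof.
elim: n x => //= n IH x.
exists (linear_form (x \o lift ord0)), (cst (x ord0)); split=> //.
  elim: {IH}n x => //= n IH x.
  exists (cst (x ord0)), (cst 0); split => //.
    exact: (IH (fun=> x ord0)).
  by move=> e s _ /=; rewrite mulr0 addr0.
by move=> e s _; rewrite linear_form_cons.
Qed.

Lemma rad_linear_form2 n (x : 'I_n -> R) :
  rad n (fun s => linear_form x s ^+ 2) = \sum_i x i ^+ 2.
Proof.
elim: n x => [|n IH] x; first by rewrite /= /linear_form !big_ord0 expr0n.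
rewrite big_ord_recl /= -radD mulrC -radZ.
transitivity (rad n (fun s => x ord0 ^+ 2 + linear_form (x \o lift ord0) s ^+ 2)).
  by congr rad; apply/funext => s; rewrite !linear_form_cons; field.
by rewrite radD rad_cst IH.
Qed.

Definition quadratic_form n (c : 'I_n -> 'I_n -> R) (s : seq R) :=
  \sum_(i < n) \sum_(j < n) s`_i * s`_j * c i j.

(** Without its diagonal a quadratic form is multilinear in the signs. *)
Lemma quadratic_form_cons n (c : 'I_n.+1 -> 'I_n.+1 -> R) e s :
  c ord0 ord0 = 0 ->
  quadratic_form c (e :: s) =
    quadratic_form (fun i j => c (lift ord0 i) (lift ord0 j)) s +
    e * linear_form
      (fun j => c ord0 (lift ord0 j) + c (lift ord0 j) ord0) s.
Proof.
move=> c0; rewrite /quadratic_form /linear_form big_ord_recl big_ord_recl /=.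
rewrite c0 mulr0 add0r mulr_sumr.
under [X in _ + X]eq_bigr do rewrite big_ord_recl /=.
rewrite big_split /= addrA -big_split /= addrC; congr (_ + _).
by apply: eq_bigr => i _; ring.
Qed.

Lemma chaos_quadratic_form n (c : 'I_n -> 'I_n -> R) :
  (forall i, c i i = 0) -> chaos n 2 (quadratic_form c).
Proof.
elim: n c => //= n IH c c0.
exists (quadratic_form (fun i j => c (lift ord0 i) (lift ord0 j))),
  (linear_form (fun j => c ord0 (lift ord0 j) + c (lift ord0 j) ord0)).
split; [exact: IH|exact: chaos_linear_form|].
by move=> e s _; rewrite quadratic_form_cons.
Qed.

Lemma rad_quadratic_form2 n (c : 'I_n -> 'I_n -> R) :
  (forall i, c i i = 0) ->
  rad n (fun s => quadratic_form c s ^+ 2) <= 2 * \sum_i \sum_j c i j ^+ 2.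
Proof.
elim: n c => [|n IH] c c0.
  by rewrite /= /quadratic_form !big_ord0 expr0n mulr0.
rewrite /= -radD mulrC -radZ.
set q := quadratic_form (fun i j => c (lift ord0 i) (lift ord0 j)).
set l := fun j => c ord0 (lift ord0 j) + c (lift ord0 j) ord0.
rewrite [leLHS](_ : _ = rad n (fun s => q s ^+ 2 + linear_form l s ^+ 2)); last first.
  by congr rad; apply/funext => s; rewrite !quadratic_form_cons// -/q -/l; field.
rewrite radD rad_linear_form2 big_ord_recl big_ord_recl /= c0 expr0n add0r.
under [X in 2 * (_ + X)]eq_bigr do rewrite big_ord_recl /=.
rewrite big_split /= addrA mulrDr [leLHS]addrC lerD//; last exact: IH.
rewrite -big_split mulr_sumr ler_sum// => j _ /=; rewrite /l.
have := sqr_ge0 (c ord0 (lift ord0 j) - c (lift ord0 j) ord0); nra.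
Qed.

Lemma rad_linear_formX16 n (x : 'I_n -> R) :
  rad n (fun s => linear_form x s ^+ 16) <= 9 ^+ 12 * (\sum_i x i ^+ 2) ^+ 8.
Proof. by rewrite -rad_linear_form2; apply: (@radX16_le n 1); exact: chaos_linear_form. Qed.

Lemma rad_quadratic_formX8 n (c : 'I_n -> 'I_n -> R) :
  (forall i, c i i = 0) ->
  rad n (fun s => quadratic_form c s ^+ 8) <=
  9 ^+ 8 * (2 * \sum_i \sum_j c i j ^+ 2) ^+ 4.
Proof.
move=> c0; rewrite (le_trans (radX8_le (chaos_quadratic_form c0)))//.
rewrite ler_pM2l ?exprn_gt0// ler_pXn2r ?rad_quadratic_form2//.
  by rewrite nnegrE rad_ge0// => s; exact: sqr_ge0.
by rewrite nnegrE mulr_ge0// sumr_ge0// => i _; rewrite sumr_ge0// => j _; exact: sqr_ge0.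
Qed.

End Rademacher.

(** * Unitary matrices and Hermitian spectra *)

Section LinearAlgebra.
Variable C : numClosedFieldType.
Implicit Types (n : nat).

Lemma exists_prim_root n : (0 < n)%N -> exists z : C, n.-primitive_root z.
Proof.
move=> n_gt0; pose p : {poly C} := 'X^n - 1.
have [r Dp] := closed_field_poly_normal p.
rewrite (monicP _) ?monicXnsubC // scale1r in Dp.
have rn1 : all n.-unity_root r.
  by apply/allP => z; rewrite -root_prod_XsubC -Dp.
have sz_r : (n < (size r).+1)%N.
  by rewrite -(size_prod_XsubC r id) -Dp size_XnsubC.
have [|z _ zn] := hasP (has_prim_root n_gt0 rn1 _ sz_r); last by exists z.
by rewrite -separable_prod_XsubC -Dp separable_Xn_sub_1 // pnatr_eq0 -lt0n.
Qed.

(** The normalized discrete Fourier transform. *)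
Lemma flat_unitary n : (0 < n)%N -> exists2 F : 'M[C]_n,
  F \is unitarymx & forall i j, F i j * (F i j)^* = n%:R^-1.
Proof.
move=> n0; have [z zn] := exists_prim_root n0.
have z1 : `|z| = 1.
  by apply/eqP; rewrite -(@pexpr_eq1 _ _ n)// -normrX (prim_expr_order zn) normr1.
have zz i : z ^+ i * (z ^+ i)^* = 1 by rewrite -normCK normrX z1 !expr1n.
have n0' : (n%:R : C) != 0 by rewrite pnatr_eq0 -lt0n.
pose F : 'M[C]_n := \matrix_(i, j) (z ^+ (i * j) / sqrtC n%:R).
have sqn : (sqrtC (n%:R : C))^-1 * ((sqrtC n%:R)^-1)^* = n%:R^-1.
  by rewrite -normCK ger0_norm ?invr_ge0 ?sqrtC_ge0 ?ler0n// exprVn sqrtCK.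
exists F; last first.
  by move=> i j; rewrite mxE rmorphM mulrACA zz mul1r sqn.
apply/unitarymxP/matrixP => i j; rewrite !mxE.
under eq_bigr do rewrite !mxE rmorphM mulrACA sqn.
rewrite -mulr_suml; have [<-|ij] := eqVneq i j.
  under eq_bigr do rewrite zz.
  by rewrite sumr_const card_ord divff.
pose w := z ^+ i * (z ^+ j)^*.
have wE k : z ^+ (i * k) * (z ^+ (j * k))^* = w ^+ k.
  by rewrite /w exprMn -rmorphXn -!exprM.
under eq_bigr do rewrite wE.
suff /eqP : (w - 1) * \sum_(k < n) w ^+ k = 0.
  rewrite mulf_eq0 => /orP[|/eqP->]; last by rewrite mul0r.
  rewrite subr_eq0 => /eqP w1; move: ij; suff -> : i = j by rewrite eqxx.
  have : z ^+ i = z ^+ j.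
    by rewrite -[LHS]mulr1 -(zz j) mulrCA -/w w1 mulr1.
  move/eqP; rewrite (eq_prim_root_expr zn) !modn_small// => /eqP.
  exact: val_inj.
rewrite -subrX1 /w exprMn -rmorphXn -!exprM ![(_ * n)%N]mulnC !exprM.
by rewrite (prim_expr_order zn) !expr1n rmorph1 mulr1 subrr.
Qed.

Lemma mxtrace_adj m n (B : 'M[C]_(m, n)) :
  \tr (B *m B^t*) = \sum_i \sum_j `|B i j| ^+ 2.
Proof.
rewrite /mxtrace; apply: eq_bigr => i _; rewrite mxE.
by apply: eq_bigr => j _; rewrite !mxE normCK.
Qed.

Lemma unitary_adjK n (S : 'M[C]_n) : S \is unitarymx -> S^t* *m S = 1%:M.
Proof.
by move=> Su; rewrite -invmx_unitary// mulVmx// unitarymx_unit.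
Qed.

Lemma unitary_conjM n (S D E : 'M[C]_n) : S \is unitarymx ->
  (S^t* *m D *m S) *m (S^t* *m E *m S) = S^t* *m (D *m E) *m S.
Proof. by move=> Su; rewrite !mulmxA mulmxtVK. Qed.

Lemma hermitian_spectralE n (A : 'M[C]_n) : A \is hermsymmx ->
  A = (spectralmx A)^t* *m diag_mx (spectral_diag A) *m spectralmx A.
Proof.
move=> /hermitian_normalmx /orthomx_spectralP {1}->.
by rewrite invmx_unitary// spectral_unitarymx.
Qed.

(** Written as an iterated product because its entries are then visibly
    polynomials in those of A. *)
Definition mx_pow n (A : 'M[C]_n) N := iter N (mulmx A) 1%:M.

Lemma mx_pow_hermitian n (A : 'M[C]_n) N : A \is hermsymmx ->
  mx_pow A N = (spectralmx A)^t* *m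
    diag_mx (\row_i (spectral_diag A 0 i) ^+ N) *m spectralmx A.
Proof.
move=> Ah; have Su := spectral_unitarymx A; elim: N => [|N IH].
  rewrite (_ : (\row_i _) = const_mx 1) ?diag_const_mx ?mulmx1 ?unitary_adjK//.
  by apply/rowP => i; rewrite !mxE.
rewrite /mx_pow iterS -/(mx_pow A N) IH.
set d := spectral_diag A; set S := spectralmx A.
rewrite [X in X *m _](hermitian_spectralE Ah) -/S -/d unitary_conjM// mulmx_diag.
suff -> : \row_i (d 0 i * (\row_i0 d 0 i0 ^+ N) 0 i) = \row_i d 0 i ^+ N.+1 by [].
by apply/rowP => i; rewrite !mxE exprS.
Qed.

(** The characteristic polynomial is invariant under unitary conjugation; this
    identifies the eigenvalues counted with multiplicity with the diagonal
    given by the spectral theorem. *)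
Lemma char_poly_hermitian n (A : 'M[C]_n) : A \is hermsymmx ->
  char_poly A = \prod_(i < n) ('X - (spectral_diag A 0 i)%:P).
Proof.
move=> Ah; rewrite {1}(hermitian_spectralE Ah).
set S := spectralmx A; set D := diag_mx _.
have Su : S \is unitarymx := spectral_unitarymx A.
rewrite -[LHS](_ : char_poly D = _).
  rewrite char_poly_trig ?diag_mx_is_trig//.
  by apply: eq_bigr => i _; rewrite mxE eqxx mulr1n.
have SS : map_mx polyC (S^t*) *m map_mx polyC S = 1%:M.
  by rewrite -map_mxM unitary_adjK// map_mx1.
rewrite /char_poly; have -> : char_poly_mx (S^t* *m D *m S) =
    map_mx polyC (S^t*) *m char_poly_mx D *m map_mx polyC S.
  rewrite /char_poly_mx !map_mxM mulmxBr mulmxBl; congr (_ - _).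
  by rewrite mul_mx_scalar -scalemxAl SS scalemx1.
by rewrite !det_mulmx mulrAC -det_mulmx SS det1 mul1r.
Qed.

Lemma hermitian_subscalar n (A : 'M[C]_n) (m : C) : A \is hermsymmx ->
  A - m%:M =
  (spectralmx A)^t* *m diag_mx (\row_i (spectral_diag A 0 i - m)) *m spectralmx A.
Proof.
move=> Ah; rewrite {1}(hermitian_spectralE Ah).
have -> : diag_mx (\row_i (spectral_diag A 0 i - m)) =
    diag_mx (spectral_diag A) - m%:M.
  by apply/matrixP => i j; rewrite !mxE -mulrnBl.
rewrite mulmxBr mulmxBl mul_mx_scalar -scalemxAl unitary_adjK ?scalemx1//.
exact: spectral_unitarymx.
Qed.

Lemma frobenius_unitary n (S X : 'M[C]_n) : S \is unitarymx ->
  \sum_i \sum_j `|(S *m X *m S^t*) i j| ^+ 2 = \sum_i \sum_j `|X i j| ^+ 2.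
Proof.
move=> Su; rewrite -!mxtrace_adj !trmx_mul !map_mxM trmxCK !mulmxA.
rewrite -[_ *m S^t* *m S]mulmxA unitary_adjK// mulmx1.
by rewrite mxtrace_mulC !mulmxA unitary_adjK// mul1mx.
Qed.

Lemma hermitian_frobenius n (A : 'M[C]_n) (m : C) : A \is hermsymmx ->
  \sum_i \sum_j `|(A - m%:M) i j| ^+ 2 = \sum_i `|spectral_diag A 0 i - m| ^+ 2.
Proof.
move=> Ah; have Su := spectral_unitarymx A.
rewrite (hermitian_subscalar _ Ah) -[X in _ *m X](trmxCK (spectralmx A)).
rewrite frobenius_unitary ?trmxC_unitary//; apply: eq_bigr => i _.
rewrite (bigD1 i)//= big1 ?addr0 => [|j ji]; first by rewrite !mxE eqxx mulr1n.
by rewrite !mxE eq_sym (negPf ji) mulr0n normr0 expr0n.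
Qed.

(** After diagonalization, the diagonal entries of F D F^* are the sums of
    |F i j|^2 D j j; when |F i j|^2 = 1 / n they all equal the normalized trace
    of D, which is zero here. *)
Lemma zero_diagonal n (A : 'M[C]_n) (m := \tr A / n%:R) : (0 < n)%N ->
  A \is hermsymmx ->
  exists2 W : 'M[C]_n, W \is unitarymx &
    forall i, (W *m (A - m%:M) *m W^t*) i i = 0.
Proof.
move=> n0 Ah; have [F Fu Ff] := flat_unitary n0.
set S := spectralmx A; set d := spectral_diag A.
have Su : S \is unitarymx := spectral_unitarymx A.
have n0' : (n%:R : C) != 0 by rewrite pnatr_eq0 -lt0n.
set D := diag_mx (\row_i (d 0 i - m)).
have trA : \tr A = \sum_i d 0 i.
  rewrite (hermitian_spectralE Ah) mxtrace_mulC mulmxA (unitarymxP Su) mul1mx.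
  by rewrite mxtrace_diag.
have BE : F *m S *m (A - m%:M) *m (F *m S)^t* = F *m D *m F^t*.
  rewrite (hermitian_subscalar _ Ah) -/S -/D trmx_mul map_mxM !mulmxA.
  by rewrite !mulmxtVK.
exists (F *m S); first exact: mul_unitarymx.
move=> i; rewrite BE mxE.
under eq_bigr do rewrite mul_mx_diag !mxE mulrAC Ff mulrC.
rewrite -mulr_suml big_split /= sumrN sumr_const card_ord -trA.
by rewrite -(mulr_natr m) divfK// subrr mul0r.
Qed.

End LinearAlgebra.

(** * Measurable enumeration of a finite family *)

Section Enumeration.
Variables (d : measure_display) (T : measurableType d) (R : realType).

Lemma expr_bounded_le1 (r K : R) : (forall N, r ^+ N <= K) -> r <= 1.
Proof.
move=> rK; rewrite leNgt; apply/negP => r1.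
have h0 : 0 < r - 1 by rewrite subr_gt0.
have bern N : 1 + N%:R * (r - 1) <= r ^+ N.
  elim: N => [|N IH]; first by rewrite mul0r addr0 expr0.
  rewrite exprS -natr1; have := ler_wpM2l (ltW (lt_trans ltr01 r1)) IH.
  have := mulr_ge0 (ler0n R N) (sqr_ge0 (r - 1)); nra.
have K0 : 0 <= K / (r - 1).
  by rewrite divr_ge0 ?(ltW h0)// (le_trans _ (rK 0%N)).
have := archi_boundP K0; set N := Num.bound _.
rewrite ltr_pdivrMr// => /lt_le_trans /(_ (le_trans _ (bern N))).
by rewrite lerDr ler01 => /(_ isT) /lt_le_trans /(_ (rK N)); rewrite ltxx.
Qed.

(** The shift c makes all the terms positive, as - x <= 1 + x^2. The sum then
    lies between its largest power (y + c)^N and (size s) times it, so that its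
    exponential growth rate in N detects whether y exceeds t. *)
Lemma seq_max_le_powersum (s : seq R) (y t : R)
    (c := 1 + \sum_(x <- s) x ^+ 2) :
  y \in s -> (forall x, x \in s -> x <= y) ->
  (y <= t) <->
  (forall N, \sum_(x <- s) (x + c) ^+ N <= (size s)%:R * (t + c) ^+ N).
Proof.
move=> ys ymax.
have xc x : x \in s -> 0 < x + c.
  move=> xs; rewrite /c (big_rem _ xs) /=.
  have : 0 <= \sum_(z <- rem x s) z ^+ 2 by apply: sumr_ge0 => i _; exact: sqr_ge0.
  have := sqr_ge0 (x + 2^-1); nra.
split => [yt N|H].
  have -> : (size s)%:R * (t + c) ^+ N = \sum_(x <- s) (t + c) ^+ N.
    by rewrite big_const_seq count_predT iter_addr_0 mulr_natl.
  rewrite big_seq [leRHS]big_seq ler_sum// => x xs.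
  rewrite lerXn2r ?nnegrE ?lerD2r ?(le_trans (ymax _ xs))//.
    by rewrite ltW// xc.
  by rewrite (le_trans (ltW (xc y ys)))// lerD2r.
have yN N : (y + c) ^+ N <= (size s)%:R * (t + c) ^+ N.
  rewrite (le_trans _ (H N))// (big_rem _ ys)/= lerDl.
  rewrite big_seq sumr_ge0// => x /mem_rem xs.
  by rewrite exprn_ge0// ltW// xc.
(* N = 1 already forces t + c to be positive *)
have tc0 : 0 < t + c.
  have := lt_le_trans (xc _ ys) (yN 1%N); rewrite expr1.
  by have := ler0n R (size s); nra.
have yc0 := xc _ ys.
have : (y + c) / (t + c) <= 1.
  apply: (@expr_bounded_le1 _ (size s)%:R) => N.
  by rewrite expr_div_n ler_pdivrMr ?exprn_gt0.
by rewrite ler_pdivrMr// mul1r lerD2r.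
Qed.

Lemma measurable_seq_max k (s : T -> seq R) (y : T -> R) :
  (forall w, size (s w) = k) ->
  (forall N, measurable_fun setT (fun w => \sum_(x <- s w) x ^+ N)) ->
  (forall w, y w \in s w) ->
  (forall w x, x \in s w -> x <= y w) ->
  measurable_fun setT y.
Proof.
move=> sk ms ys ymax.
pose c w := 1 + \sum_(x <- s w) x ^+ 2.
have mc : measurable_fun setT c by apply: measurable_funD => //; exact: ms.
move=> mT; apply: (measurability _ (RGenOInfty.measurableE R)) => //.
move=> _ [_ [t ->] <-]; rewrite setTI.
pose lhs N w := \sum_(x <- s w) (x + c w) ^+ N.
pose rhs N w := k%:R * (t + c w) ^+ N.
have -> : y @^-1` `]t, +oo[ = ~` \bigcap_N [set w | lhs N w <= rhs N w].
  apply/seteqP; split=> w /=; rewrite in_itv /= andbT.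
    move=> ty H; move: ty; rewrite ltNge => /negP; apply.
    apply: (seq_max_le_powersum _ (ys w) (ymax w)).2 => N.
    by have := H N I; rewrite /= /lhs /rhs sk.
  move=> H; rewrite ltNge; apply/negP => yt; apply: H => N _ /=.
  by rewrite /lhs /rhs -(sk w); apply: (seq_max_le_powersum _ (ys w) (ymax w)).1.
apply/measurableC/bigcapT_measurable => N.
rewrite -[X in measurable X]setTI; apply: measurable_fun_le => //.
  rewrite (_ : lhs N = fun w => \sum_(i < N.+1)
      (c w ^+ i *+ 'C(N, i)) * \sum_(x <- s w) x ^+ (N - i)).
    apply: measurable_sum => i; apply: measurable_funM; last exact: ms.
    under eq_fun do rewrite -mulr_natr.
    by apply: measurable_funM => //; exact: measurable_funX.
  apply/funext => w; rewrite /lhs.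
  under [RHS]eq_bigr do rewrite mulr_sumr.
  rewrite exchange_big; apply: eq_bigr => x _; rewrite exprDn.
  by apply: eq_bigr => i _ /=; rewrite mulrnAl mulrC.
apply: measurable_funM => //; apply: measurable_funX.
exact: measurable_funD.
Qed.

(** Measurable power sums determine everything: the maximum is measurable, and
    removing it subtracts its powers from the power sums. No measurability of
    the terms of s in their given order is assumed. *)
Lemma measurable_enumeration k (s : T -> seq R) :
  (forall w, size (s w) = k) ->
  (forall N, measurable_fun setT (fun w => \sum_(x <- s w) x ^+ N)) ->
  exists2 l : nat -> T -> R, forall j, measurable_fun setT (l j) &
    forall w, perm_eq (s w) (mkseq (l^~ w) k).
Proof.
elim: k s => [|k IH] s sk ms.
  by exists (fun=> cst 0) => // w; rewrite (size0nil (sk w)).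
have /choice[y yP] w : exists y, y \in s w /\ forall x, x \in s w -> x <= y.
  have : s w != [::] by rewrite -size_eq0 sk.
  elim: (s w) => //= a [|b u] IHu _.
    by exists a; split=> [|x]; rewrite inE// => /eqP->.
  have [//|m [mu um]] := IHu; have [am|ma] := leP a m.
    exists m; split=> [|x]; first by rewrite inE mu orbT.
    by rewrite inE => /predU1P[->//|/um].
  exists a; split=> [|x]; first by rewrite mem_head.
  by rewrite inE => /predU1P[->//|/um/le_trans]; apply; exact: ltW.
have ys w : y w \in s w by case: (yP w).
have my : measurable_fun setT y.
  by apply: (measurable_seq_max sk ms) => // w; case: (yP w).
have [|N|l ml lP] := IH (fun w => rem (y w) (s w)).
- by move=> w; rewrite size_rem// sk.
- rewrite (_ : (fun _ => _) = fun w => \sum_(x <- s w) x ^+ N - y w ^+ N).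
    by apply: measurable_funB; [exact: ms|exact: measurable_funX].
  by apply/funext => w; rewrite (big_rem _ (ys w))/= addrAC subrr add0r.
- exists (fun j => if j is i.+1 then l i else y); first by case.
  move=> w; rewrite (perm_trans (perm_to_rem (ys w)))//.
  rewrite -[mkseq _ _]/(y w :: [seq _ | j <- iota 1 k]) perm_cons.
  by rewrite -[1%N]addn1 add0n (iotaDl 1 0) -map_comp.
Qed.

End Enumeration.

(** * Borel measurability of complex functions *)

Section ComplexMeasurability.
Variable R : realType.

Lemma Re_norm_le (z : R[i]) : (`|complex.Re z|%:C : R[i]) <= `|z|.
Proof.
rewrite normc_def lecR -sqrtr_sqr ler_wsqrtr// lerDl sqr_ge0//.
Qed.

Lemma Im_norm_le (z : R[i]) : (`|complex.Im z|%:C : R[i]) <= `|z|.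
Proof. by rewrite normc_def lecR -sqrtr_sqr ler_wsqrtr// lerDr sqr_ge0. Qed.

Lemma Re_continuous : continuous (@complex.Re R : R[i] -> R).
Proof.
move=> z A /nbhs_ballP[e /= e0 eA].
apply/(@nbhs_ballP R[i] R[i]); exists e%:C; first by rewrite /= ltcR.
move=> t; rewrite /ball /= => zt; apply: eA; rewrite /ball /=.
rewrite -ltcR (le_lt_trans _ zt)// -(raddfB (@complex.Re R : Rcomplex R -> R)).
exact: Re_norm_le.
Qed.

Lemma Im_continuous : continuous (@complex.Im R : R[i] -> R).
Proof.
move=> z A /nbhs_ballP[e /= e0 eA].
apply/(@nbhs_ballP R[i] R[i]); exists e%:C; first by rewrite /= ltcR.
move=> t; rewrite /ball /= => zt; apply: eA; rewrite /ball /=.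
rewrite -ltcR (le_lt_trans _ zt)// -(raddfB (@complex.Im R : Rcomplex R -> R)).
exact: Im_norm_le.
Qed.

Lemma real_complex_continuous : continuous (real_complex R : R -> R[i]).
Proof.
move=> x A /nbhs_ballP[e /= e0 eA].
have {e0}[r eE r0] : exists2 r, e = r%:C & 0 < r.
  by case: e e0 {eA} => r s; rewrite ltcE /= => /andP[/eqP-> r0]; exists r.
apply/nbhs_ballP; exists r => //= y; rewrite /ball /= => xy.
apply: eA; rewrite /ball /= -rmorphB /= eE normc_def /= expr0n addr0 sqrtr_sqr.
by rewrite ltcR.
Qed.

(** Measurability through real and imaginary parts: this form is stable under
    ring operations by the corresponding facts for real functions, without
    second countability of the product topology. *)
Definition cmeasurable d (T : measurableType d) (f : T -> R[i]) :=
  measurable_fun setT (fun w => complex.Re (f w)) /\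
  measurable_fun setT (fun w => complex.Im (f w)).

Lemma continuous_measurable_borel (T : ptopologicalType) (f : T -> R) :
  continuous f -> measurable_fun setT (f : borel T -> R).
Proof.
move=> /continuousP cf mT; apply: (measurability _ (RGenOpens.measurableE R)) => //.
move=> _ [_ [a [b ->] <-]]; rewrite setTI.
by apply: sub_sigma_algebra; apply/cf/interval_open.
Qed.

Lemma cmeasurable_entry n i j :
  cmeasurable (fun M : borel 'M[R[i]]_n => (M : 'M[R[i]]_n) i j).
Proof.
split; apply: (continuous_measurable_borel (T := 'M[R[i]]_n)) => M.
  by apply: continuous_comp; [exact: coord_continuous|exact: Re_continuous].
by apply: continuous_comp; [exact: coord_continuous|exact: Im_continuous].
Qed.

Section Closure.
Variables (d : measure_display) (T : measurableType d).
Implicit Types f g : T -> R[i].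

Lemma cmeasurable_comp d' (T' : measurableType d') (f : T' -> R[i]) (g : T -> T') :
  cmeasurable f -> measurable_fun setT g -> cmeasurable (f \o g).
Proof.
by move=> [fr fi] mg; split; [exact: (measurableT_comp fr)|exact: (measurableT_comp fi)].
Qed.

Lemma cmeasurable_cst (z : R[i]) : cmeasurable (fun _ : T => z).
Proof. by split; exact: measurable_cst. Qed.

Lemma cmeasurableD f g : cmeasurable f -> cmeasurable g ->
  cmeasurable (fun w => f w + g w).
Proof.
move=> [fr fi] [gr gi]; split.
  rewrite (_ : (fun _ => _) = fun w => complex.Re (f w) + complex.Re (g w)).
    exact: measurable_funD.
  by apply/funext => w; rewrite (raddfD (@complex.Re R : Rcomplex R -> R)).
rewrite (_ : (fun _ => _) = fun w => complex.Im (f w) + complex.Im (g w)).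
  exact: measurable_funD.
by apply/funext => w; rewrite (raddfD (@complex.Im R : Rcomplex R -> R)).
Qed.

Lemma cmeasurableM f g : cmeasurable f -> cmeasurable g ->
  cmeasurable (fun w => f w * g w).
Proof.
move=> [fr fi] [gr gi]; split.
  rewrite (_ : (fun _ => _) = fun w => complex.Re (f w) * complex.Re (g w) -
      complex.Im (f w) * complex.Im (g w)).
    by apply: measurable_funB; exact: measurable_funM.
  by apply/funext => w; case: (f w); case: (g w).
rewrite (_ : (fun _ => _) = fun w => complex.Re (f w) * complex.Im (g w) +
    complex.Im (f w) * complex.Re (g w)).
  by apply: measurable_funD; exact: measurable_funM.
by apply/funext => w; case: (f w); case: (g w).
Qed.

Lemma cmeasurable_conj f : cmeasurable f -> cmeasurable (fun w => (f w)^*%R).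
Proof.
move=> [fr fi]; split.
  rewrite (_ : (fun _ => _) = fun w => complex.Re (f w))//.
  by apply/funext => w; case: (f w).
rewrite (_ : (fun _ => _) = fun w => - complex.Im (f w)).
  exact: measurable_funN.
by apply/funext => w; case: (f w).
Qed.

Lemma cmeasurable_sum I (r : seq I) (f : I -> T -> R[i]) :
  (forall i, cmeasurable (f i)) -> cmeasurable (fun w => \sum_(i <- r) f i w).
Proof.
move=> mf; elim: r => [|i r IH].
  by under eq_fun do rewrite big_nil; exact: cmeasurable_cst.
by under eq_fun do rewrite big_cons; exact: cmeasurableD.
Qed.

Lemma cmeasurable_mulmx m n p (A : T -> 'M[R[i]]_(m, n)) (B : T -> 'M[R[i]]_(n, p)) :
  (forall i j, cmeasurable (fun w => A w i j)) ->
  (forall i j, cmeasurable (fun w => B w i j)) ->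
  forall i j, cmeasurable (fun w => (A w *m B w) i j).
Proof.
move=> mA mB i j; under eq_fun do rewrite mxE.
by apply: cmeasurable_sum => l; exact: cmeasurableM.
Qed.


End Closure.
End ComplexMeasurability.

(** * Sign randomization of a Haar unitary matrix *)

Section HaarMoments.
Local Open Scope ereal_scope.
Variables (R : realType) (d : measure_display) (Omega : measurableType d)
  (P : probability Omega R).

(** Both integrals are integrals of |y| against the common law on the line. *)
Lemma eq_law_integral (X Y : Omega -> R) :
  measurable_fun setT X -> measurable_fun setT Y ->
  (forall w, 0 <= X w)%R -> (forall w, 0 <= Y w)%R ->
  (forall S, measurable S -> P (X @^-1` S) = P (Y @^-1` S)) ->
  \int[P]_w (X w)%:E = \int[P]_w (Y w)%:E.
Proof.
move=> mX mY X0 Y0 XY.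
pose X' : {mfun Omega >-> R} := HB.pack X (isMeasurableFun.Build _ _ _ _ _ mX).
pose Y' : {mfun Omega >-> R} := HB.pack Y (isMeasurableFun.Build _ _ _ _ _ mY).
have law (Z : {mfun Omega >-> R}) : (forall w, 0 <= Z w)%R ->
    \int[P]_w (Z w)%:E = \int[pushforward P Z]_y `|y|%:E.
  move=> Z0; rewrite ge0_integral_pushforward//.
  - by apply: eq_integral => w _ /=; rewrite ger0_norm.
  - by apply/measurable_EFinP; exact: normr_measurable.
rewrite (law X' X0) (law Y' Y0).
by apply: eq_measure_integral => S mS _; exact: XY.
Qed.

(** Invariance is only known for Borel sets of matrices; F transports it to the
    laws of the real random variables F (U V) and F U. *)
Lemma haar_integral_mulr n (U : Omega -> 'M[R[i]]_n) (V : 'M[R[i]]_n)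
    (F : 'M[R[i]]_n -> R) :
  haar_distributed P U -> V \is unitarymx ->
  measurable_fun setT (F : borel 'M[R[i]]_n -> R) ->
  measurable_fun setT (fun w => F (U w *m V)) ->
  (forall M, 0 <= F M)%R ->
  \int[P]_w (F (U w *m V))%:E = \int[P]_w (F (U w))%:E.
Proof.
move=> [mU _ _ Uinv] uV mF mFV F0.
apply: eq_law_integral => // [|S mS].
  exact: (measurableT_comp mF mU).
apply: (Uinv V (F @^-1` S)) => //.
by rewrite -[X in measurable X]setTI; exact: mF.
Qed.

Definition signs n (s : seq R) := (size s == n) && all (fun e => e ^+ 2 == 1)%R s.

Lemma measurable_rad n (g : seq R -> Omega -> R) :
  (forall s, measurable_fun setT (g s)) ->
  measurable_fun setT (fun w => rad n (g ^~ w)).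
Proof.
elim: n g => [|n IH] g mg /=; first exact: mg.
apply: measurable_funM => //; apply: measurable_funD.
  exact: (IH (fun s => g (1 :: s)%R)).
exact: (IH (fun s => g (- 1 :: s)%R)).
Qed.

Lemma integral_rad n (g : seq R -> Omega -> R) (I : \bar R) :
  (forall s, measurable_fun setT (g s)) -> (forall s w, 0 <= g s w)%R ->
  (forall s, signs n s -> \int[P]_w (g s w)%:E = I) ->
  \int[P]_w (rad n (g ^~ w))%:E = I.
Proof.
elim: n g => [|n IH] g mg g0 gI /=; first exact: gI.
under eq_integral do rewrite EFinM EFinD.
have ge0 e w : (0 <= rad n (fun s => g (e :: s) w))%R by exact: rad_ge0.
have mr e : measurable_fun setT (fun w => (rad n (fun s => g (e :: s) w))%:E).
  by apply/measurable_EFinP; exact: (measurable_rad n (g := fun s => g (e :: s))).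
have rI e : (e ^+ 2 = 1)%R -> \int[P]_w (rad n (fun s => g (e :: s) w))%:E = I.
  move=> e1; apply: (IH (fun s => g (e :: s))) => // s /andP[/eqP ss sa].
  by apply: gI; rewrite /signs /= ss eqxx e1 eqxx.
under eq_integral do rewrite muleC.
rewrite ge0_integralZl//; last 2 first.
- by apply: emeasurable_funD; exact: mr.
- by move=> w _; rewrite adde_ge0 ?lee_fin.
rewrite ge0_integralD//; last 2 first.
- by move=> w _; rewrite lee_fin.
- by move=> w _; rewrite lee_fin.
rewrite !rI ?sqrrN ?expr1n// -mule2n -mule_natl muleA -EFinM mulVf ?mul1e//.
Qed.

Definition sign_mx n (s : seq R) : 'M[R[i]]_n := diag_mx (\row_i (s`_i)%:C).

Lemma sign_mx_unitary n s : signs n s -> sign_mx n s \is unitarymx.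
Proof.
move=> /andP[/eqP sn /allP s1]; apply/unitarymxP.
rewrite tr_diag_mx map_diag_mx mulmx_diag -diag_const_mx; congr diag_mx.
apply/rowP => i; rewrite !mxE.
have /s1/eqP si : nth 0%R s i \in s by rewrite mem_nth// sn.
by rewrite -normCK normc_def /= expr0n addr0 si sqrtr1 expr1n.
Qed.

(** The randomization step: F U may be replaced by its average over all
    F (U D W), with D a diagonal matrix of signs, and this average can be
    bounded for each fixed value of U. *)
Lemma haar_sign_average n (U : Omega -> 'M[R[i]]_n) (W : 'M[R[i]]_n)
    (F G : 'M[R[i]]_n -> R) :
  haar_distributed P U -> W \is unitarymx ->
  measurable_fun setT (F : borel 'M[R[i]]_n -> R) ->
  (forall V, measurable_fun setT (fun w => F (U w *m V))) ->
  measurable_fun setT (fun w => G (U w)) ->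
  (forall M, 0 <= F M)%R ->
  (forall M, M \is unitarymx -> rad n (fun s => F (M *m (sign_mx n s *m W))) <= G M)%R ->
  \int[P]_w (F (U w))%:E <= \int[P]_w (G (U w))%:E.
Proof.
move=> hU uW mF mFV mG F0 FG.
rewrite -(@integral_rad n (fun s w => F (U w *m (sign_mx n s *m W)))
   (\int[P]_w (F (U w))%:E))//; last first.
  move=> s sn; have uV := mul_unitarymx (sign_mx_unitary sn) uW.
  exact: (haar_integral_mulr hU uV mF (mFV _) F0).
have [_ uU _ _] := hU.
apply: ge0_le_integral => //.
- by move=> w _; rewrite lee_fin rad_ge0.
- apply/measurable_EFinP.
  exact: (measurable_rad n (g := fun s w => F (U w *m (sign_mx n s *m W)))).
- exact/measurable_EFinP.
- by move=> w _; rewrite lee_fin; exact: (FG _ (uU w)).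
Qed.

End HaarMoments.

(** * Pointwise bounds on sign averages *)

Section SquaredModulus.
Variable R : realType.
Implicit Types z : R[i].

Definition sqn z : R := complex.Re z ^+ 2 + complex.Im z ^+ 2.

Lemma sqnE z : (sqn z)%:C = `|z| ^+ 2.
Proof. exact: add_Re2_Im2. Qed.

Lemma sqn_ge0 z : 0 <= sqn z.
Proof. by rewrite addr_ge0 ?sqr_ge0. Qed.

Lemma sqnM z1 z2 : sqn (z1 * z2) = sqn z1 * sqn z2.
Proof. by case: z1 => a b; case: z2 => e f; rewrite /sqn /=; ring. Qed.

Lemma sqn_conj z : sqn z^*%R = sqn z.
Proof. by case: z => a b; rewrite /sqn /= sqrrN. Qed.

Lemma Re_sum I (r : seq I) (f : I -> R[i]) :
  complex.Re (\sum_(i <- r) f i) = \sum_(i <- r) complex.Re (f i).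
Proof. exact: (raddf_sum (@complex.Re R : Rcomplex R -> R)). Qed.

Lemma Im_sum I (r : seq I) (f : I -> R[i]) :
  complex.Im (\sum_(i <- r) f i) = \sum_(i <- r) complex.Im (f i).
Proof. exact: (raddf_sum (@complex.Im R : Rcomplex R -> R)). Qed.

Lemma real_complex_sum I (r : seq I) (f : I -> R) :
  (\sum_(i <- r) f i)%:C = \sum_(i <- r) (f i)%:C.
Proof. exact: (raddf_sum (real_complex R)). Qed.

Lemma Re_realM (a : R) z : complex.Re (a%:C * z) = a * complex.Re z.
Proof. by case: z => x y /=; rewrite mul0r subr0. Qed.

Lemma Im_realM (a : R) z : complex.Im (a%:C * z) = a * complex.Im z.
Proof. by case: z => x y /=; rewrite mul0r addr0. Qed.

Lemma unitary_row_sqn n (M : 'M[R[i]]_n) i : M \is unitarymx ->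
  \sum_j sqn (M i j) = 1.
Proof.
move=> /unitarymxP/matrixP/(_ i i); rewrite !mxE eqxx mulr1n => Mi.
apply: (@complexI R); rewrite real_complex_sum rmorph1 -Mi.
by apply: eq_bigr => j _; rewrite sqnE normCK !mxE.
Qed.

Lemma exprD4_le (a b : R) : (a + b) ^+ 4 <= 8 * (a ^+ 4 + b ^+ 4).
Proof.
have sqD (x y : R) : (x + y) ^+ 2 <= 2 * (x ^+ 2 + y ^+ 2).
  by have := sqr_ge0 (x - y); nra.
rewrite -[4%N]/(2 * 2)%N !exprM.
have := sqD (a ^+ 2) (b ^+ 2).
have : ((a + b) ^+ 2) ^+ 2 <= (2 * (a ^+ 2 + b ^+ 2)) ^+ 2.
  by rewrite ler_pXn2r ?sqD// nnegrE ?sqr_ge0 ?mulr_ge0 ?addr_ge0 ?sqr_ge0.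
lra.
Qed.

Lemma exprD8_le (a b : R) : (a + b) ^+ 8 <= 128 * (a ^+ 8 + b ^+ 8).
Proof.
have := exprD4_le (a ^+ 2) (b ^+ 2); rewrite -!exprM -[(2 * 4)%N]/8%N.
have -> : (a + b) ^+ 8 = ((a + b) ^+ 2) ^+ 4 by rewrite -exprM.
have : ((a + b) ^+ 2) ^+ 4 <= (2 * (a ^+ 2 + b ^+ 2)) ^+ 4.
  rewrite ler_pXn2r// ?nnegrE ?sqr_ge0 ?mulr_ge0 ?addr_ge0 ?sqr_ge0//.
  by have := sqr_ge0 (a - b); nra.
rewrite exprMn; lra.
Qed.

(** The Cauchy-Schwarz inequality for a weighted sum, by induction on the
    range. *)
Lemma weighted_sum_sqr_le I (r : seq I) (w y : I -> R) : (forall i, 0 <= w i) ->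
  (\sum_(i <- r) w i * y i) ^+ 2 <=
  (\sum_(i <- r) w i) * \sum_(i <- r) w i * y i ^+ 2.
Proof.
move=> w0; elim: r => [|i r IH]; first by rewrite !big_nil mul0r expr0n.
rewrite !big_cons; move: IH.
have : 0 <= \sum_(i <- r) w i by rewrite sumr_ge0.
have : 0 <= \sum_(i <- r) w i * y i ^+ 2.
  by rewrite sumr_ge0// => j _; rewrite mulr_ge0 ?sqr_ge0.
set A := \sum_(_ <- _) _; set B := \sum_(_ <- _) _; set C := \sum_(_ <- _) _.
move=> A0 B0 CAB; have wi := w0 i.
have cross : 2 * C * y i <= B * y i ^+ 2 + A.
  rewrite (le_trans (ler_norm _))// -(@ler_pXn2r _ 2) ?nnegrE//; last first.
    by rewrite addr_ge0// mulr_ge0 ?sqr_ge0.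
  rewrite -normrX ger0_norm ?sqr_ge0//.
  have := ler_wpM2r (sqr_ge0 (y i)) CAB; have := sqr_ge0 (B * y i ^+ 2 - A); nra.
have := ler_wpM2l wi cross; nra.
Qed.

Lemma weighted_sumX4_le I (r : seq I) (w y : I -> R) : (forall i, 0 <= w i) ->
  (\sum_(i <- r) w i * y i) ^+ 4 <=
  (\sum_(i <- r) w i) ^+ 3 * \sum_(i <- r) w i * y i ^+ 4.
Proof.
move=> w0; have W0 : 0 <= \sum_(i <- r) w i by rewrite sumr_ge0.
have W2 : 0 <= \sum_(i <- r) w i * y i ^+ 2.
  by rewrite sumr_ge0// => i _; rewrite mulr_ge0 ?sqr_ge0.
have h1 := weighted_sum_sqr_le r y w0.
have h2 := weighted_sum_sqr_le r (fun i => y i ^+ 2) w0.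
rewrite -[4%N]/(2 * 2)%N exprM.
have h3 : (\sum_(i <- r) w i * y i) ^+ 2 ^+ 2 <=
    ((\sum_(i <- r) w i) * \sum_(i <- r) w i * y i ^+ 2) ^+ 2.
  by rewrite ler_pXn2r ?h1// nnegrE ?sqr_ge0 ?mulr_ge0.
rewrite (le_trans h3)// exprMn (exprSr _ 2) -mulrA ler_wpM2l ?sqr_ge0//.
rewrite (le_trans h2)// ler_wpM2l// le_eqVlt; apply/orP; left; apply/eqP.
by apply: eq_bigr => i _; rewrite -exprM.
Qed.

End SquaredModulus.

Section DeterministicBounds.
Variables (R : realType) (n : nat).
Implicit Types M B W : 'M[R[i]]_n.

(** The entry (i, j) of M B M^*, expanded so that each summand involves one
    entry of row i and one entry of row j of M. *)
Definition sesq B M i j : R[i] := \sum_a \sum_b M i a * B a b * (M j b)^*.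

(** The real and the imaginary part of the entry are linear forms in the signs
    with total variance 1 / n, since the rows of M are unit vectors and W is
    flat. *)
Lemma rad_entry_le M W i j : M \is unitarymx ->
  (forall a b, sqn (W a b) = n%:R^-1) ->
  rad n (fun s => sqn ((M *m (sign_mx n s *m W)) i j) ^+ 8) <=
  2 ^+ 8 * 9 ^+ 12 * n%:R^-1 ^+ 8.
Proof.
move=> uM Wn; pose z a := M i a * W a j.
have zE s : (M *m (sign_mx n s *m W)) i j = \sum_(a < n) (s`_a)%:C * z a.
  rewrite mxE; apply: eq_bigr => a _.
  by rewrite mul_diag_mx !mxE mulrCA.
pose x a := complex.Re (z a); pose y a := complex.Im (z a).
have sE s : sqn ((M *m (sign_mx n s *m W)) i j) =
    linear_form x s ^+ 2 + linear_form y s ^+ 2.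
  rewrite zE /sqn Re_sum Im_sum; congr (_ ^+ 2 + _ ^+ 2).
    by apply: eq_bigr => a _; rewrite Re_realM.
  by apply: eq_bigr => a _; rewrite Im_realM.
have Sz : \sum_a sqn (z a) = n%:R^-1.
  under eq_bigr do rewrite sqnM Wn.
  by rewrite -mulr_suml unitary_row_sqn// mul1r.
have xz : rad n (fun s => linear_form x s ^+ 16) <= 9 ^+ 12 * n%:R^-1 ^+ 8.
  rewrite (le_trans (rad_linear_formX16 x))// ler_pM2l ?exprn_gt0//.
  rewrite ler_pXn2r// ?nnegrE ?invr_ge0//.
    by rewrite -Sz ler_sum// => a _; rewrite lerDl sqr_ge0.
  by rewrite sumr_ge0// => a _; exact: sqr_ge0.
have yz : rad n (fun s => linear_form y s ^+ 16) <= 9 ^+ 12 * n%:R^-1 ^+ 8.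
  rewrite (le_trans (rad_linear_formX16 y))// ler_pM2l ?exprn_gt0//.
  rewrite ler_pXn2r// ?nnegrE ?invr_ge0//.
    by rewrite -Sz ler_sum// => a _; rewrite lerDr sqr_ge0.
  by rewrite sumr_ge0// => a _; exact: sqr_ge0.
have : rad n (fun s => sqn ((M *m (sign_mx n s *m W)) i j) ^+ 8) <=
    128 * (rad n (fun s => linear_form x s ^+ 16) +
           rad n (fun s => linear_form y s ^+ 16)).
  rewrite -radD -radZ; apply: rad_le => s; rewrite sE.
  by rewrite (le_trans (exprD8_le _ _))// -!exprM.
move=> /le_trans; apply; have -> : 2 ^+ 8 = 256 :> R by ring.
by move: xz yz; rewrite -mulrA; set K : R := 9 ^+ 12 * n%:R^-1 ^+ 8; lra.
Qed.

(** The real and the imaginary part are quadratic forms in the signs, with no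
    diagonal term because B has none. Their second moments are at most 2 S,
    with S the sum of the |B a b|^2 |M i a|^2 |M j b|^2; the fourth power of S is
    then brought inside the sum by convexity, with the weights |B a b|^2. *)
Lemma rad_sesq_le M B i j : (forall a, B a a = 0) ->
  rad n (fun s => sqn (sesq B (M *m (sign_mx n s *m 1%:M)) i j) ^+ 4) <=
  2 ^+ 8 * 9 ^+ 8 *
  ((\sum_a \sum_b sqn (B a b)) ^+ 3 *
   \sum_a \sum_b sqn (B a b) * ((sqn (M i a) ^+ 8 + sqn (M j b) ^+ 8) / 2)).
Proof.
move=> B0; pose z a b := M i a * B a b * (M j b)^*%R.
have zE s : sesq B (M *m (sign_mx n s *m 1%:M)) i j =
    \sum_(a < n) \sum_(b < n) (s`_a * s`_b)%:C * z a b.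
  apply: eq_bigr => a _; apply: eq_bigr => b _.
  rewrite mulmx1 mul_mx_diag !mxE rmorphM rmorphM /= /z.
  have -> : ((s`_b)%:C : R[i])^*%R = (s`_b)%:C by exact: conjc_real.
  by ring.
pose x a b := complex.Re (z a b); pose y a b := complex.Im (z a b).
have sE s : sqn (sesq B (M *m (sign_mx n s *m 1%:M)) i j) =
    quadratic_form x s ^+ 2 + quadratic_form y s ^+ 2.
  rewrite zE /sqn Re_sum Im_sum; congr (_ ^+ 2 + _ ^+ 2).
    apply: eq_bigr => a _; rewrite Re_sum; apply: eq_bigr => b _.
    by rewrite Re_realM.
  apply: eq_bigr => a _; rewrite Im_sum; apply: eq_bigr => b _.
  by rewrite Im_realM.
have z0 a : z a a = 0 by rewrite /z B0 mulr0 mul0r.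
set S := \sum_a \sum_b sqn (z a b).
have S0 : 0 <= S by rewrite sumr_ge0// => a _; rewrite sumr_ge0// => b _; exact: sqn_ge0.
have xz : rad n (fun s => quadratic_form x s ^+ 8) <= 9 ^+ 8 * (2 * S) ^+ 4.
  rewrite (le_trans (rad_quadratic_formX8 _))//; first by move=> a; rewrite /x z0.
  rewrite ler_pM2l ?exprn_gt0// ler_pXn2r// ?nnegrE ?mulr_ge0//.
    rewrite ler_pM2l// ler_sum// => a _; rewrite ler_sum// => b _.
    by rewrite lerDl sqr_ge0.
  by rewrite sumr_ge0// => a _; rewrite sumr_ge0// => b _; exact: sqr_ge0.
have yz : rad n (fun s => quadratic_form y s ^+ 8) <= 9 ^+ 8 * (2 * S) ^+ 4.
  rewrite (le_trans (rad_quadratic_formX8 _))//; first by move=> a; rewrite /y z0.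
  rewrite ler_pM2l ?exprn_gt0// ler_pXn2r// ?nnegrE ?mulr_ge0//.
    rewrite ler_pM2l// ler_sum// => a _; rewrite ler_sum// => b _.
    by rewrite lerDr sqr_ge0.
  by rewrite sumr_ge0// => a _; rewrite sumr_ge0// => b _; exact: sqr_ge0.
have : rad n (fun s => sqn (sesq B (M *m (sign_mx n s *m 1%:M)) i j) ^+ 4) <=
    8 * (rad n (fun s => quadratic_form x s ^+ 8) +
         rad n (fun s => quadratic_form y s ^+ 8)).
  rewrite -radD -radZ; apply: rad_le => s; rewrite sE.
  by rewrite (le_trans (exprD4_le _ _))// -!exprM.
move=> /le_trans; apply.
have : S ^+ 4 <= (\sum_a \sum_b sqn (B a b)) ^+ 3 *
   \sum_a \sum_b sqn (B a b) * ((sqn (M i a) ^+ 8 + sqn (M j b) ^+ 8) / 2).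
  rewrite !pair_big /=.
  pose u (p : 'I_n * 'I_n) := sqn (M i p.1) * sqn (M j p.2).
  have -> : S = \sum_(p : 'I_n * 'I_n) sqn (B p.1 p.2) * u p.
    rewrite /S pair_big; apply: eq_bigr => p _ /=.
    by rewrite /z !sqnM sqn_conj /u; ring.
  rewrite (le_trans (weighted_sumX4_le _ _ _))//; first by move=> p; exact: sqn_ge0.
  rewrite ler_wpM2l ?exprn_ge0 ?sumr_ge0// => [p _|]; first exact: sqn_ge0.
  apply: ler_sum => p _; rewrite ler_wpM2l ?sqn_ge0// /u exprMn.
  have := sqr_ge0 (sqn (M i p.1) ^+ 4 - sqn (M j p.2) ^+ 4).
  rewrite sqrrB -!exprM; lra.
rewrite exprMn in xz yz *; lra.
Qed.

End DeterministicBounds.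

(** * Moments of the entries of a Haar unitary matrix *)

Section HermitianSpectrum.
Variables (R : realType) (n : nat) (A : 'M[R[i]]_n).
Hypothesis Ah : A \is hermsymmx.

(** The eigenvalues with multiplicity, as real numbers. *)
Definition spectrum : seq R := [seq complex.Re (spectral_diag A 0 i) | i <- enum 'I_n].

Lemma spectral_diag_Re i : spectral_diag A 0 i = (complex.Re (spectral_diag A 0 i))%:C.
Proof.
have /mxOverP/(_ 0 i)/RRe_real := hermitian_spectral_diag_real Ah.
by move=> ->.
Qed.

Lemma spectrum_eigenvals : perm_eq (eigenvals A) [seq x%:C | x <- spectrum].
Proof.
apply: prod_XsubC_eq; rewrite -char_poly_eigenvals char_poly_hermitian//.
rewrite big_map big_map big_enum; apply: eq_bigr => i _.
by rewrite -spectral_diag_Re.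
Qed.

Lemma spectrum_eigenvalue x : x \in spectrum -> eigenvalue A x%:C.
Proof.
move=> xA; rewrite eigenvalue_root_char char_poly_eigenvals root_prod_XsubC.
by rewrite (perm_mem spectrum_eigenvals) map_f.
Qed.

Lemma size_spectrum : size spectrum = n.
Proof. by rewrite size_map size_enum_ord. Qed.

End HermitianSpectrum.

(** The product of the factors 2^8 * 9^8 of [rad_sesq_le] and 2^8 * 9^12 of
    [rad_entry_le]. *)
Definition moment_cst (R : realType) : R := 2 ^+ 16 * 9 ^+ 20.

Lemma moment_cst_gt0 (R : realType) : 0 < moment_cst R.
Proof. by rewrite /moment_cst mulr_gt0 ?exprn_gt0. Qed.

Section HaarCompression.
Local Open Scope ereal_scope.
Variables (R : realType) (d : measure_display) (Omega : measurableType d)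
  (P : probability Omega R).

Lemma integral_prob_cst (c : R) : \int[P]_w c%:E = c%:E.
Proof.
rewrite -[LHS]/(\int[P]_(w in setT) cst c%:E w) integral_cst//.
have P1 : P setT = 1 by exact: probability_setT.
by rewrite [X in _ * X]P1 mule1.
Qed.

Lemma measurable_sqn d' (T : measurableType d') (f : T -> R[i]) :
  cmeasurable f -> measurable_fun setT (fun w => sqn (f w)).
Proof.
by move=> [fr fi]; apply: measurable_funD; exact: measurable_funX.
Qed.

Lemma cmeasurable_haar n (U : Omega -> 'M[R[i]]_n) i j :
  haar_distributed P U -> cmeasurable (fun w => U w i j).
Proof.
by move=> [mU _ _ _]; exact: (cmeasurable_comp (cmeasurable_entry R i j) mU).
Qed.

Lemma cmeasurable_sesq d' (T : measurableType d') n (B : 'M[R[i]]_n)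
    (M : T -> 'M[R[i]]_n) i j :
  (forall a b, cmeasurable (fun w => M w a b)) ->
  cmeasurable (fun w => sesq B (M w) i j).
Proof.
move=> mM; apply: cmeasurable_sum => a; apply: cmeasurable_sum => b.
apply: cmeasurableM; last exact/cmeasurable_conj.
by apply: cmeasurableM => //; exact: cmeasurable_cst.
Qed.

(** E |U i j|^16 = O(n^(-8)), the order of a Gaussian entry of variance 1 / n. *)
Lemma haar_entry_moment n (U : Omega -> 'M[R[i]]_n) i j : (0 < n)%N ->
  haar_distributed P U ->
  \int[P]_w (sqn (U w i j) ^+ 8)%:E <= (2 ^+ 8 * 9 ^+ 12 * n%:R^-1 ^+ 8)%:E.
Proof.
move=> n0 hU; have [F uF Fn] := flat_unitary R[i] n0.
have Fn' a b : sqn (F a b) = n%:R^-1%R.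
  by apply: (@complexI R); rewrite sqnE normCK Fn fmorphV rmorph_nat.
set K := (X in _ <= X%:E).
rewrite (le_trans (@haar_sign_average _ _ _ _ _ _ F (fun M => sqn (M i j) ^+ 8)%R
  (cst K) hU uF _ _ _ _ _))//.
- by apply: measurable_funX; apply/measurable_sqn/cmeasurable_entry.
- move=> V; apply: measurable_funX; apply: measurable_sqn.
  apply: cmeasurable_mulmx => a b; first exact: cmeasurable_haar.
  exact: cmeasurable_cst.
- by move=> M; rewrite exprn_ge0// sqn_ge0.
- by move=> M uM; exact: rad_entry_le.
by rewrite -[leLHS]/(\int[P]_w K%:E) integral_prob_cst.
Qed.

Lemma haar_sesq_moment n (U : Omega -> 'M[R[i]]_n) (B : 'M[R[i]]_n) i j :
  (0 < n)%N -> haar_distributed P U -> (forall a, B a a = 0)%R ->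
  \int[P]_w (sqn (sesq B (U w) i j) ^+ 4)%:E <=
  (moment_cst R * (\sum_a \sum_b sqn (B a b)) ^+ 4 * n%:R^-1 ^+ 8)%:E.
Proof.
move=> n0 hU B0; set S := (\sum_a _)%R.
have S0 : (0 <= S)%R.
  by rewrite sumr_ge0// => a _; rewrite sumr_ge0// => b _; exact: sqn_ge0.
pose c (p : 'I_n * 'I_n) : R := (2 ^+ 7 * 9 ^+ 8 * S ^+ 3 * sqn (B p.1 p.2))%R.
have c0 p : (0 <= c p)%R by rewrite !mulr_ge0 ?exprn_ge0// sqn_ge0.
pose G (M : 'M[R[i]]_n) : R :=
  (\sum_p c p * (sqn (M i p.1) ^+ 8 + sqn (M j p.2) ^+ 8))%R.
have mU a b : measurable_fun setT (fun w => sqn (U w a b) ^+ 8)%R.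
  by apply/measurable_funX/measurable_sqn/cmeasurable_haar.
have sqn8 (z : R[i]) : (0 <= sqn z ^+ 8)%R by rewrite exprn_ge0// sqn_ge0.
have mG p : measurable_fun setT
    (fun w => c p * (sqn (U w i p.1) ^+ 8 + sqn (U w j p.2) ^+ 8))%R.
  by apply: measurable_funM => //; exact: measurable_funD.
have u1 : (1%:M : 'M[R[i]]_n) \is unitarymx.
  by apply/unitarymxP; rewrite trmx1 map_mx1 mulmx1.
rewrite (le_trans (@haar_sign_average _ _ _ _ _ _ 1%:M
  (fun M => sqn (sesq B M i j) ^+ 4)%R G hU u1 _ _ _ _ _))//.
- by apply/measurable_funX/measurable_sqn/cmeasurable_sesq => a b; exact: cmeasurable_entry.
- move=> V; apply/measurable_funX/measurable_sqn/cmeasurable_sesq.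
  apply: cmeasurable_mulmx => a b; first exact: cmeasurable_haar.
  exact: cmeasurable_cst.
- exact: measurable_sum.
- by move=> M; rewrite exprn_ge0// sqn_ge0.
- move=> M uM; apply: (le_trans (rad_sesq_le M i j B0)).
  rewrite -/S pair_big /= !mulr_sumr ler_sum// => p _.
  by rewrite /c le_eqVlt; apply/orP; left; apply/eqP; field.
pose K : R := (2 ^+ 8 * 9 ^+ 12 * n%:R^-1 ^+ 8)%R.
under eq_integral do rewrite -sumEFin.
rewrite ge0_integral_sum//; last 2 first.
- by move=> p; exact/measurable_EFinP.
- by move=> p w _; rewrite lee_fin mulr_ge0// addr_ge0.
rewrite (@le_trans _ _ (\sum_(p : 'I_n * 'I_n) (c p * (K + K))%:E))//.
  apply: lee_sum => p _.
  under eq_integral do rewrite EFinM EFinD.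
  rewrite ge0_integralZl ?lee_fin//; last 2 first.
  - by apply: emeasurable_funD; exact/measurable_EFinP.
  - by move=> w _; rewrite -EFinD lee_fin addr_ge0.
  rewrite ge0_integralD//; last 4 first.
  - by move=> w _; rewrite lee_fin.
  - exact/measurable_EFinP.
  - by move=> w _; rewrite lee_fin.
  - exact/measurable_EFinP.
  rewrite (EFinM (c p)) (EFinD K) lee_wpmul2l ?lee_fin// leeD//; exact: haar_entry_moment.
rewrite sumEFin lee_fin -mulr_suml -mulr_sumr.
have -> : (\sum_(p : 'I_n * 'I_n) sqn (B p.1 p.2) = S)%R by rewrite /S pair_big.
rewrite le_eqVlt; apply/orP; left; apply/eqP; rewrite /K /moment_cst.
by ring.
Qed.

End HaarCompression.

(** * Concentration of the compressed matrix *)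

Section Compression.
Variable R : realType.

Lemma pid_mxM (C : pzRingType) k n m (kn : (k <= n)%N) (X : 'M[C]_(n, m)) :
  (pid_mx k : 'M[C]_(k, n)) *m X = rowsub (widen_ord kn) X.
Proof.
apply/matrixP => i j; rewrite !mxE (bigD1 (widen_ord kn i))//= big1 => [|l li].
  by rewrite !mxE /= eqxx ltn_ord mul1r addr0.
rewrite !mxE /= (_ : (i == l :> nat) = false) ?mul0r//.
by apply: contra_neqF li => /eqP il; exact: val_inj.
Qed.

Lemma compressionE k n (kn : (k <= n)%N) (U A : 'M[R[i]]_n) :
  compression k U A = mxsub (widen_ord kn) (widen_ord kn) (U *m A *m U^t*).
Proof.
set X := U *m A *m U^t*.
have -> : compression k U A = pid_mx k *m X *m (pid_mx k)^t*.
  by rewrite /X !mulmxA.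
rewrite (pid_mxM kn).
transitivity (((pid_mx k : 'M[R[i]]_(k, n)) *m (rowsub (widen_ord kn) X)^t*)^t*).
  by rewrite trmx_mul map_mxM trmxCK.
by rewrite (pid_mxM kn); apply/matrixP => i j; rewrite !mxE conjCK.
Qed.

Lemma hermsymmxE n (A : 'M[R[i]]_n) : (A \is hermsymmx) = (A^t* == A).
Proof.
by rewrite is_hermitianmxE expr0 scale1r eq_sym.
Qed.

Lemma compression_hermitian k n (U A : 'M[R[i]]_n) :
  A \is hermsymmx -> compression k U A \is hermsymmx.
Proof.
rewrite !hermsymmxE => /eqP AA; apply/eqP; rewrite /compression.
by rewrite !trmx_mul !map_mxM !trmxCK AA !mulmxA.
Qed.

Lemma compression_sub_scalar k n (U A : 'M[R[i]]_n) (m : R[i]) : (k <= n)%N ->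
  U \is unitarymx ->
  compression k U A - m%:M = compression k U (A - m%:M).
Proof.
move=> kn uU; rewrite !(compressionE kn) mulmxBr mulmxBl mul_mx_scalar -scalemxAl.
rewrite (unitarymxP uU) scalemx1; apply/matrixP => i j; rewrite !mxE.
by congr (_ - (_ *+ nat_of_bool _)); apply/eqP/eqP => [[/val_inj]|->].
Qed.

Lemma compression_sesq k n (kn : (k <= n)%N) (U B : 'M[R[i]]_n) i j :
  compression k U B i j = sesq B U (widen_ord kn i) (widen_ord kn j).
Proof.
rewrite (compressionE kn) !mxE /sesq exchange_big; apply: eq_bigr => b _.
by rewrite !mxE mulr_suml.
Qed.

Lemma spectrum_frobenius n (A : 'M[R[i]]_n) (m : R) : A \is hermsymmx ->
  \sum_(x <- spectrum A) (x - m) ^+ 2 = \sum_i \sum_j sqn ((A - m%:C%:M) i j).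
Proof.
move=> Ah; apply: (@complexI R); rewrite !real_complex_sum.
under [RHS]eq_bigr do [rewrite real_complex_sum; under eq_bigr do rewrite sqnE].
rewrite hermitian_frobenius// big_map big_enum; apply: eq_bigr => i _ /=.
by rewrite (spectral_diag_Re Ah) /= -rmorphB -sqnE /sqn /= expr0n addr0.
Qed.

(** This makes the power sums of the eigenvalues of a random Hermitian matrix
    measurable. *)
Lemma spectrum_powersum n (A : 'M[R[i]]_n) N : A \is hermsymmx ->
  \sum_(x <- spectrum A) x ^+ N = complex.Re (\tr (mx_pow A N)).
Proof.
move=> Ah; rewrite mx_pow_hermitian// mxtrace_mulC mulmxA.
rewrite (unitarymxP (spectral_unitarymx A)) mul1mx mxtrace_diag Re_sum.
rewrite big_map big_enum; apply: eq_bigr => i _; rewrite mxE.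
by rewrite {2}(spectral_diag_Re Ah) -rmorphXn.
Qed.

Lemma hermitian_mean n (A : 'M[R[i]]_n) : A \is hermsymmx ->
  \tr A / n%:R = ((\sum_(x <- spectrum A) x) / n%:R)%:C.
Proof.
move=> Ah; rewrite rmorphM fmorphV rmorph_nat; congr (_ / _).
rewrite [X in \tr X](hermitian_spectralE Ah) mxtrace_mulC mulmxA.
rewrite (unitarymxP (spectral_unitarymx A)) mul1mx mxtrace_diag.
rewrite rmorph_sum big_map big_enum; apply: eq_bigr => i _.
exact: spectral_diag_Re.
Qed.

(** The eigenvalues and their mean both lie in [-L, L]. *)
Lemma spectrum_variance_le n (A : 'M[R[i]]_n) (L : R)
    (m := (\sum_(x <- spectrum A) x) / n%:R) : (0 < n)%N ->
  A \is hermsymmx ->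
  (forall a : R[i], eigenvalue A a -> (- L)%:C <= a <= L%:C) ->
  \sum_(x <- spectrum A) (x - m) ^+ 2 <= n%:R * (4 * L ^+ 2).
Proof.
move=> n0 Ah AL.
have xL x : x \in spectrum A -> - L <= x <= L.
  by move=> /(spectrum_eigenvalue Ah)/AL; rewrite !lecR.
have n0' : 0 < n%:R :> R by rewrite ltr0n.
have csum (a : R) : n%:R * a = \sum_(x <- spectrum A) a.
  by rewrite big_const_seq count_predT iter_addr_0 size_spectrum mulr_natl.
have mL : - L <= m <= L.
  rewrite /m ler_pdivlMr// ler_pdivrMr// ![_ * n%:R]mulrC !csum.
  by rewrite !big_seq !ler_sum// => x /xL/andP[].
rewrite csum big_seq [leRHS]big_seq ler_sum// => x /xL.
by move: mL => /andP[? ?] /andP[? ?]; nra.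
Qed.

(** With W from [zero_diagonal], B = W (A - m) W^* and V = U W^*, the matrix
    U (A - m) U^* equals V B V^*, and V has the law of U.
    The squared Frobenius norm of B is at most 4 n L^2, so its fourth power
    turns the bound n^(-8) of [haar_sesq_moment] into n^(-4). *)
Lemma haar_compression_moment (d : measure_display) (Omega : measurableType d)
    (P : probability Omega R) k n (U : Omega -> 'M[R[i]]_n) (A : 'M[R[i]]_n)
    (L : R) (m := (\sum_(x <- spectrum A) x) / n%:R) i j :
  (0 < n)%N -> (k <= n)%N -> haar_distributed P U -> A \is hermsymmx ->
  (forall a : R[i], eigenvalue A a -> (- L)%:C <= a <= L%:C) ->
  (\int[P]_w (sqn ((compression k (U w) A - m%:C%:M) i j) ^+ 4)%:E <=
  (moment_cst R * (4 * L ^+ 2) ^+ 4 * n%:R^-1 ^+ 4)%:E)%E.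
Proof.
move=> n0 kn hU Ah AL; have [W uW] := zero_diagonal n0 Ah.
rewrite (hermitian_mean Ah) -/m; set B := W *m _ *m _ => B0.
have [_ uU _ _] := hU.
pose F (M : 'M[R[i]]_n) := sqn (sesq B M (widen_ord kn i) (widen_ord kn j)) ^+ 4.
have FE w : sqn ((compression k (U w) A - m%:C%:M) i j) ^+ 4 = F (U w *m W^t*).
  rewrite (compression_sub_scalar _ _ kn (uU w)) /F -compression_sesq.
  suff -> : compression k (U w) (A - m%:C%:M) = compression k (U w *m W^t*) B by [].
  rewrite !(compressionE kn); congr mxsub.
  by rewrite /B trmx_mul map_mxM trmxCK !mulmxA !mulmxKtV.
under eq_integral do rewrite FE.
rewrite haar_integral_mulr ?trmxC_unitary//; last 3 first.
- by apply/measurable_funX/measurable_sqn/cmeasurable_sesq => a b; exact: cmeasurable_entry.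
- apply/measurable_funX/measurable_sqn/cmeasurable_sesq.
  apply: cmeasurable_mulmx => a b; first exact: cmeasurable_haar hU.
  exact: cmeasurable_cst.
- by move=> M; rewrite exprn_ge0// sqn_ge0.
rewrite (le_trans (haar_sesq_moment _ _ n0 hU B0))// lee_fin.
set S := \sum_a _; have SE : S = \sum_(x <- spectrum A) (x - m) ^+ 2.
  rewrite spectrum_frobenius//; apply: (@complexI R); rewrite /S !real_complex_sum.
  under eq_bigr do [rewrite real_complex_sum; under eq_bigr do rewrite sqnE].
  under [RHS]eq_bigr do [rewrite real_complex_sum; under eq_bigr do rewrite sqnE].
  exact: frobenius_unitary.
have S0 : 0 <= S by rewrite SE sumr_ge0// => x _; exact: sqr_ge0.
have SL : S <= n%:R * (4 * L ^+ 2) by rewrite SE spectrum_variance_le.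
have n0' : n%:R != 0 :> R by rewrite pnatr_eq0 -lt0n.
rewrite -(mulrA _ (S ^+ 4)) -(mulrA _ ((4 * L ^+ 2) ^+ 4)).
have -> : (4 * L ^+ 2) ^+ 4 * n%:R^-1 ^+ 4 =
    (n%:R * (4 * L ^+ 2)) ^+ 4 * n%:R^-1 ^+ 8 by field.
rewrite ler_pM2l ?moment_cst_gt0//.
rewrite ler_wpM2r ?exprn_ge0 ?invr_ge0// ler_pXn2r// nnegrE.
by rewrite (le_trans S0).
Qed.

End Compression.

(** * Borel-Cantelli and couplings *)

Section AlmostSure.
Local Open Scope ereal_scope.
Variables (R : realType) (d : measure_display) (Omega : measurableType d)
  (P : probability Omega R).

(** The series of the Y N has a finite integral, hence converges almost surely,
    so that its terms tend to zero. *)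
Lemma ae_eventually_le1 (Y : nat -> Omega -> R) (c : nat -> R) (B : R) :
  (forall N, measurable_fun setT (Y N)) -> (forall N w, 0 <= Y N w)%R ->
  (forall N, \int[P]_w (Y N w)%:E <= (c N)%:E) ->
  (forall m, \sum_(N < m) c N <= B)%R ->
  {ae P, forall w, \forall N \near \oo, (Y N w <= 1)%R}.
Proof.
move=> mY Y0 Yc cB.
have EY N w : 0 <= (Y N w)%:E by rewrite lee_fin.
have mEY N : measurable_fun setT (EFin \o Y N) by exact/measurable_EFinP.
have S0 w : 0 <= \sum_(N <oo) (Y N w)%:E by apply: nneseries_ge0.
have intS : P.-integrable setT (fun w => \sum_(N <oo) (Y N w)%:E).
  apply/integrableP; split.
    exact: (ge0_emeasurable_sum (P := xpredT) (fun N w _ _ => EY N w) (fun N _ => mEY N)).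
  under eq_integral do rewrite gee0_abs//.
  rewrite integral_nneseries//; apply: (@le_lt_trans _ _ B%:E); last exact: ltry.
  apply: lime_le; first by apply: is_cvg_nneseries => N _ _; exact: integral_ge0.
  apply: nearW => m; rewrite big_mkord.
  rewrite (@le_trans _ _ (\sum_(N < m) (c N)%:E))//; first exact: lee_sum.
  by rewrite sumEFin lee_fin.
have := integrable_ae measurableT intS; apply: filterS => w /(_ I) finw.
have : cvgn (series (Y ^~ w)).
  by apply: nnseries_is_cvg => // ; rewrite ltey_eq finw.
move=> /cvg_series_cvg_0 /cvgrPdist_lt /(_ _ ltr01).
apply: filterS => N; rewrite sub0r normrN ger0_norm//.
exact: ltW.
Qed.

End AlmostSure.

Section MassOne.
Variables (d : measure_display) (T : measurableType d) (R : realType)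
  (mu : {measure set T -> \bar R}).
Hypothesis mu1 : mu setT = 1%E.

(** A copy of mu, on which the structure of probability can be declared. *)
Definition mass_one : set T -> \bar R := mu.

HB.instance Definition _ := isMeasure.Build _ _ _ mass_one
  (measure0 mu) (measure_ge0 mu) (@measure_semi_sigma_additive _ _ _ mu).

HB.instance Definition _ := Measure_isProbability.Build _ _ _ mass_one mu1.

Lemma mass_one_probability :
  exists pi : probability T R, pi = mu :> (set T -> \bar R).
Proof. by exists mass_one. Qed.

End MassOne.

Section Coupling.
Local Open Scope ereal_scope.
Variables (R : realType) (d : measure_display) (Omega : measurableType d)
  (P : probability Omega R).

Lemma measurable_real_complex :
  measurable_fun setT (real_complex R : R -> borel R[i]).
Proof.
move=> mT; apply: (@measurability _ _ _ (borel R[i]) _ _ (@open R[i])) => //.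
move=> _ [B oB <-]; rewrite setTI; apply: open_measurable.
by move/continuousP : (@real_complex_continuous R); apply.
Qed.

Lemma normc_sqrt (z : R[i]) : Normc.normc z = Num.sqrt (sqn z).
Proof. by case: z. Qed.

Lemma measurable_sqrt : measurable_fun setT (@Num.sqrt R).
Proof. by apply: continuous_measurable_fun; exact: sqrt_continuous. Qed.

Lemma measurable_dist : measurable_fun setT
  (fun p : borel R[i] * borel R[i] => Normc.normc ((p.1 : R[i]) - p.2)%R).
Proof.
have mc : cmeasurable (fun z : borel R[i] => z : R[i]).
  by split; apply: (continuous_measurable_borel (T := R[i]));
    [exact: Re_continuous|exact: Im_continuous].
under eq_fun do rewrite normc_sqrt.
apply: (measurableT_comp measurable_sqrt); apply: measurable_sqn.
apply: cmeasurableD; first exact: (cmeasurable_comp mc measurable_fst).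
under eq_fun do rewrite -mulN1r.
apply: cmeasurableM; first exact: cmeasurable_cst.
exact: (cmeasurable_comp mc measurable_snd).
Qed.

(** The coupling is the mean over j of the laws of (z j, l j). *)
Lemma d1_le_mean (k : nat) (z : nat -> R) (l : nat -> Omega -> R)
    (mu rho : set (borel R[i]) -> \bar R) :
  (0 < k)%N -> (forall j, measurable_fun setT (l j)) ->
  (forall S, measurable S ->
     mu S = (k%:R^-1)%:E * \sum_(j < k) \d_((z j)%:C : borel R[i]) S) ->
  (forall S, measurable S ->
     rho S = (k%:R^-1)%:E * \sum_(j < k) P [set w | S (l j w)%:C]) ->
  d1 mu rho <= (k%:R^-1)%:E * \sum_(j < k) \int[P]_w `|z j - l j w|%:E.
Proof.
move=> k0 ml muE rhoE.
pose f j w : borel R[i] * borel R[i] := ((z j)%:C, (l j w)%:C).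
have mf j : measurable_fun setT (f j).
  apply: measurable_fun_pair => //.
  exact: (measurableT_comp measurable_real_complex (ml j)).
pose f' j : {mfun Omega >-> (borel R[i] * borel R[i])%type} :=
  HB.pack (f j) (isMeasurableFun.Build _ _ _ _ _ (mf j)).
pose m_ j : {measure set (borel R[i] * borel R[i]) -> \bar R} := distribution P (f' j).
have k0' : (0 <= k%:R^-1 :> R)%R by rewrite invr_ge0.
pose pi0 := mscale (NngNum k0') (msum m_ k).
have piE S : pi0 S = (k%:R^-1)%:E * \sum_(j < k) P (f j @^-1` S) by [].
have kk : (k%:R^-1 * k%:R = 1 :> R)%R by rewrite mulVf// pnatr_eq0 -lt0n.
have P1 : P setT = 1 by exact: probability_setT.
have pi1 : pi0 setT = 1.
  rewrite piE (eq_bigr (fun=> 1%:E)) => [|j _]; last by rewrite preimage_setT.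
  by rewrite sumEFin sumr_const card_ord -EFinM kk.
have [pi pi_eq] := mass_one_probability pi1.
have cpi : coupling mu rho pi.
  move=> S mS; split; rewrite pi_eq [LHS]piE ?muE ?rhoE//; congr (_ * _).
    apply: eq_bigr => j _; rewrite diracE; have [zS|zS] := boolP (_ \in S).
      rewrite (_ : _ @^-1` _ = setT)//; apply/seteqP; split => w //= _.
      by split => //; exact: set_mem zS.
    rewrite (_ : _ @^-1` _ = set0) ?measure0//; apply/seteqP; split => w //= [].
    by move=> /mem_set zS'; rewrite zS' in zS.
  apply: eq_bigr => j _; congr (P _); apply/seteqP; split => w /=; first by case.
  by split.
rewrite (@le_trans _ _ (\int[pi]_p (Normc.normc ((p.1 : R[i]) - p.2)%R)%:E))//.
  by apply: ereal_inf_lbound; exists pi.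
have mdist : measurable_fun setT (fun p : borel R[i] * borel R[i] =>
    (Normc.normc ((p.1 : R[i]) - p.2)%R)%:E).
  by apply/measurable_EFinP; exact: measurable_dist.
have dist0 (p : borel R[i] * borel R[i]) :
    0 <= (Normc.normc ((p.1 : R[i]) - p.2)%R)%:E.
  by rewrite lee_fin normc_sqrt sqrtr_ge0.
rewrite pi_eq [leLHS]ge0_integral_mscale//= ge0_integral_measure_sum//.
rewrite le_eqVlt; apply/orP; left; apply/eqP; congr (_ * _).
apply: eq_bigr => j _; rewrite [LHS]ge0_integral_pushforward//.
apply: eq_integral => w _ /=.
by rewrite oppr0 addr0 expr0n addr0 sqrtr_sqr.
Qed.

End Coupling.

(** * The rate n^(-1/3) *)

Section CubeRoot.
Variable R : realType.

Definition cbrtV n : R := n%:R `^ (- (1 / 3)).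

Lemma cbrtVX3 n : cbrtV n ^+ 3 = n%:R^-1.
Proof.
rewrite /cbrtV -powR_mulrn ?powR_ge0// -powRrM.
by rewrite mulNr div1r mulVf// powR_inv1.
Qed.

Lemma cbrtV_gt0 n : (0 < n)%N -> 0 < cbrtV n.
Proof. by move=> n0; rewrite powR_gt0// ltr0n. Qed.

Lemma cbrtV_le1 n : (0 < n)%N -> cbrtV n <= 1.
Proof.
move=> n0; rewrite -(@ler_pXn2r _ 3) ?nnegrE ?(ltW (cbrtV_gt0 n0))//.
by rewrite cbrtVX3 expr1n invf_le1 ?ltr0n// ler1n.
Qed.

(** With u = n^(-1/3) and v = (n + 1)^(-1/3), the relation u^(-3) + 1 = v^(-3)
    reads u^3 - v^3 = u^3 v^3, and u^3 - v^3 <= 3 u^2 (u - v). Hence the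
    exponents -4/3 sum to a telescoping series. *)
Lemma cbrtVX4_le n : (0 < n)%N ->
  cbrtV n.+1 ^+ 4 <= 3 * (cbrtV n - cbrtV n.+1).
Proof.
move=> n0; have u0 := cbrtV_gt0 n0; have v0 := cbrtV_gt0 (ltn0Sn n).
have u3 := cbrtVX3 n; have v3 := cbrtVX3 n.+1.
move: (cbrtV n) (cbrtV n.+1) u0 v0 u3 v3 => u v u0 v0 u3 v3.
have n0' : n%:R != 0 :> R by rewrite pnatr_eq0 -lt0n.
have n1' : n%:R + 1 != 0 :> R by rewrite natr1 pnatr_eq0.
have uv3 : u ^+ 3 - v ^+ 3 = u ^+ 3 * v ^+ 3.
  by rewrite u3 v3 -natr1; field; rewrite n0' n1'.
have vu : v <= u.
  rewrite -(@ler_pXn2r _ 3) ?nnegrE ?(ltW u0) ?(ltW v0)// -subr_ge0 uv3 mulr_ge0// exprn_ge0//.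
    exact: ltW.
  exact: ltW.
have : u ^+ 2 * (u * v ^+ 3) <= u ^+ 2 * (3 * (u - v)).
  have -> : u ^+ 2 * (u * v ^+ 3) = u ^+ 3 - v ^+ 3 by rewrite uv3; ring.
  have -> : u ^+ 3 - v ^+ 3 = (u - v) * (u ^+ 2 + u * v + v ^+ 2) by ring.
  have -> : u ^+ 2 * (3 * (u - v)) = (u - v) * (3 * u ^+ 2) by ring.
  by rewrite ler_wpM2l ?subr_ge0//; nra.
rewrite ler_pM2l ?exprn_gt0//; apply: le_trans.
by rewrite exprS ler_wpM2r// exprn_ge0// ltW.
Qed.

Lemma sum_cbrtVX4_le p m : (0 < p)%N ->
  \sum_(N < m) cbrtV (N + p).+1 ^+ 4 <= 3.
Proof.
move=> p0; suff H : \sum_(N < m) cbrtV (N + p).+1 ^+ 4 <=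
    3 * (cbrtV p - cbrtV (m + p)).
  have mp : (0 < m + p)%N by rewrite addn_gt0 p0 orbT.
  by have := cbrtV_le1 p0; have := cbrtV_gt0 mp; move: H; lra.
elim: m => [|m IH]; first by rewrite big_ord0 add0n subrr mulr0.
rewrite big_ord_recr /= addSn.
have mp : (0 < m + p)%N by rewrite addn_gt0 p0 orbT.
by have := cbrtVX4_le mp; move: IH; lra.
Qed.

End CubeRoot.

(** * Distance between the spectral measure and its mean *)

Section Deviation.
Variables (R : realType) (d : measure_display) (Omega : measurableType d)
  (P : probability Omega R) (k n : nat) (L : R)
  (U : Omega -> 'M[R[i]]_n) (A : 'M[R[i]]_n).
Hypotheses (k0 : (0 < k)%N) (kn : (k <= n)%N) (Ah : A \is hermsymmx)
  (AL : forall a : R[i], eigenvalue A a -> (- L)%:C <= a <= L%:C)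
  (hU : haar_distributed P U).

Let n0 : (0 < n)%N. Proof. exact: leq_trans kn. Qed.

Definition mean_spectrum : R := (\sum_(x <- spectrum A) x) / n%:R.

Definition compression_spectrum w : seq R := spectrum (compression k (U w) A).

(** This controls each eigenvalue ([sqr_le_deviation]) and is polynomial in the
    entries of the compression ([deviationE]). *)
Definition deviation w : R :=
  \sum_(x <- compression_spectrum w) (x - mean_spectrum) ^+ 2.

Lemma deviation_ge0 w : 0 <= deviation w.
Proof. by rewrite sumr_ge0// => x _; exact: sqr_ge0. Qed.

Lemma sqr_le_deviation w x :
  x \in compression_spectrum w -> (x - mean_spectrum) ^+ 2 <= deviation w.
Proof.
move=> xs; rewrite /deviation (big_rem _ xs) /= lerDl sumr_ge0// => y _.
exact: sqr_ge0.
Qed.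

Lemma deviationE w : deviation w = \sum_(p : 'I_k * 'I_k)
  sqn ((compression k (U w) A - mean_spectrum%:C%:M) p.1 p.2).
Proof.
by rewrite /deviation spectrum_frobenius ?compression_hermitian// pair_big.
Qed.

Lemma cmeasurable_compression (B : 'M[R[i]]_n) i j :
  cmeasurable (fun w => compression k (U w) B i j).
Proof.
under eq_fun do rewrite (compression_sesq kn).
by apply: cmeasurable_sesq => a b; exact: cmeasurable_haar hU.
Qed.

Lemma measurable_deviation_entry i j : measurable_fun setT
  (fun w => sqn ((compression k (U w) A - mean_spectrum%:C%:M) i j)).
Proof.
apply: measurable_sqn; have [_ uU _ _] := hU.
under eq_fun do rewrite compression_sub_scalar//.
exact: cmeasurable_compression.
Qed.

Lemma measurable_deviation : measurable_fun setT deviation.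
Proof.
rewrite (funext deviationE).
by apply: measurable_sum => p; exact: measurable_deviation_entry.
Qed.

Definition deviation_cst : R := k%:R ^+ 8 * (moment_cst R * (4 * L ^+ 2) ^+ 4).

Lemma deviation_cst_ge0 : 0 <= deviation_cst.
Proof.
rewrite /deviation_cst mulr_ge0 ?exprn_ge0// mulr_ge0 ?(ltW (moment_cst_gt0 R))//.
by rewrite exprn_ge0// mulr_ge0// sqr_ge0.
Qed.

Lemma deviation_moment :
  (\int[P]_w (deviation w ^+ 4)%:E <= (deviation_cst * n%:R^-1 ^+ 4)%:E)%E.
Proof.
pose y p w := sqn ((compression k (U w) A - mean_spectrum%:C%:M) p.1 p.2).
have my (p : 'I_k * 'I_k) : measurable_fun setT (fun w => y p w ^+ 4).
  by apply: measurable_funX; exact: measurable_deviation_entry.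
have y0 (p : 'I_k * 'I_k) w : 0 <= y p w ^+ 4 by rewrite exprn_ge0// sqn_ge0.
pose K : R := moment_cst R * (4 * L ^+ 2) ^+ 4 * n%:R^-1 ^+ 4.
have dy w : deviation w ^+ 4 <= (k%:R ^+ 2) ^+ 3 * \sum_p y p w ^+ 4.
  have := @weighted_sumX4_le _ _ (index_enum ('I_k * 'I_k)%type) (fun=> 1) (y ^~ w) (fun=> ler01).
  rewrite sumr_const card_prod card_ord natrM -expr2 deviationE.
  under eq_bigr do rewrite mul1r.
  by under [X in _ <= _ * X]eq_bigr do rewrite mul1r.
apply: (@le_trans _ _ (\int[P]_w ((k%:R ^+ 2) ^+ 3 * \sum_p y p w ^+ 4)%:E)%E).
  apply: ge0_le_integral => //.
  - by move=> w _; rewrite lee_fin exprn_ge0// deviation_ge0.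
  - by apply/measurable_EFinP/measurable_funX; exact: measurable_deviation.
  - apply/measurable_EFinP; apply: measurable_funM => //.
    exact: measurable_sum.
  - by move=> w _; rewrite lee_fin.
under eq_integral do rewrite EFinM -sumEFin.
rewrite ge0_integralZl ?lee_fin ?exprn_ge0//; last 2 first.
- by apply: emeasurable_sum => p; exact/measurable_EFinP.
- by move=> w _; rewrite sume_ge0// => p _; rewrite lee_fin.
rewrite ge0_integral_sum//; last 2 first.
- by move=> p; exact/measurable_EFinP.
- by move=> p w _; rewrite lee_fin.
have -> : deviation_cst * n%:R^-1 ^+ 4 =
    (k%:R ^+ 2) ^+ 3 * \sum_(p : 'I_k * 'I_k) K.
  by rewrite sumr_const card_prod card_ord -(mulr_natr K) natrM /deviation_cst /K; ring.
rewrite (EFinM (_ ^+ 3)) -sumEFin lee_wpmul2l ?lee_fin ?exprn_ge0//.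
by apply: lee_sum => p _; exact: haar_compression_moment.
Qed.

Lemma measurable_compression_eigenvalues :
  exists2 l : nat -> Omega -> R, forall j, measurable_fun setT (l j) &
    forall w, perm_eq (compression_spectrum w) (mkseq (l^~ w) k).
Proof.
apply: measurable_enumeration => [w|N]; first exact: size_spectrum.
under eq_fun do rewrite spectrum_powersum ?compression_hermitian//.
have mpow : forall N i j, cmeasurable (fun w => mx_pow (compression k (U w) A) N i j).
  elim=> [|N' IH] i j; first exact: cmeasurable_cst.
  by apply: cmeasurable_mulmx => a b //; exact: cmeasurable_compression.
by have [] := cmeasurable_sum (index_enum 'I_k) (fun i => mpow N i i).
Qed.

(** Both measures are compared with the point mass at [mean_spectrum]. For the
    random eigenvalues, |t| <= e + e^(-7) D^4 as soon as t^2 <= D, and the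
    fourth moment of the deviation is of order e^12. *)
Lemma d1_spectral_measure_le (C := 2 + deviation_cst) w0 :
  deviation w0 <= cbrtV R n ^+ 2 ->
  (d1 (spectral_measure (compression k (U w0) A))
     (mean_measure P (fun w => spectral_measure (compression k (U w) A)))
   <= (C * cbrtV R n)%:E)%E.
Proof.
move=> dev0; have [l ml lP] := measurable_compression_eigenvalues.
set m := mean_spectrum.
have lin j w : (j < k)%N -> l j w \in compression_spectrum w.
  by move=> jk; rewrite (perm_mem (lP w)) map_f// mem_iota.
have e0 := cbrtV_gt0 R n0; have e1 := cbrtV_le1 R n0; have e3 := cbrtVX3 R n.
move: (cbrtV R n) e0 e1 e3 dev0 => e e0 e1 e3 dev0.
have muE w S : spectral_measure (compression k (U w) A) S =
    ((k%:R^-1)%:E * \sum_(j < k) \d_((l j w)%:C : borel R[i]) S)%E.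
  rewrite /spectral_measure; congr (_ * _)%E.
  rewrite (perm_big _ (spectrum_eigenvals (compression_hermitian _ _ Ah))).
  rewrite big_map (perm_big _ (lP w)) big_map.
  by rewrite -[X in iota 0 X]subn0 big_mkord.
have lS j (S : set (borel R[i])) : measurable S -> measurable [set w | S (l j w)%:C].
  move=> mS; rewrite -[X in measurable X]setTI.
  have := measurableT_comp (@measurable_real_complex R) (ml j).
  by move=> /(_ measurableT _ mS).
have k0' : k%:R != 0 :> R by rewrite pnatr_eq0 -lt0n.
apply: (le_trans (@d1_le_mean _ _ _ P k (l^~ w0) l _ _ k0 ml _ _)).
- by move=> S _; exact: muE.
- move=> S mS; rewrite /mean_measure; under eq_integral do rewrite muE.
  have mdirac j : measurable_fun setT (fun w => \d_((l j w)%:C : borel R[i]) S : \bar R).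
    have -> : (fun w => \d_((l j w)%:C : borel R[i]) S : \bar R) =
      EFin \o \1_[set w | S (l j w)%:C].
      by apply/funext => w /=; rewrite diracE indicE.
    by apply/measurable_EFinP/measurable_indic; exact: lS.
  rewrite ge0_integralZl ?lee_fin ?invr_ge0//; last 2 first.
  + by apply: emeasurable_sum => j; exact: mdirac.
  + by move=> w _; rewrite sume_ge0.
  rewrite ge0_integral_sum//; congr (_ * _)%E; apply: eq_bigr => j _.
  by rewrite -[X in P X]setIT -integral_indic//; exact: lS.
(* if e < |t| then e^7 |t| <= |t|^8 <= D^4 *)
have abs_le t D : t ^+ 2 <= D -> `|t| <= e + e^-1 ^+ 7 * D ^+ 4.
  move=> tD; have D0 : 0 <= D by rewrite (le_trans _ tD)// sqr_ge0.
  have D4 : 0 <= e^-1 ^+ 7 * D ^+ 4 by rewrite mulr_ge0 ?exprn_ge0 ?invr_ge0// ltW.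
  have [te|et] := leP `|t| e; first by rewrite (le_trans te)// lerDl.
  rewrite (@le_trans _ _ (e^-1 ^+ 7 * D ^+ 4))//; last by rewrite lerDr ltW.
  rewrite exprVn ler_pdivlMl ?exprn_gt0//.
  apply: (@le_trans _ _ (`|t| ^+ 8)).
    by rewrite [leRHS]exprSr ler_wpM2r// lerXn2r ?nnegrE ?(ltW e0) ?(ltW et).
  rewrite -[8%N]/(2 * 4)%N exprM real_normK ?num_real//.
  by rewrite lerXn2r ?nnegrE ?sqr_ge0.
have int_le j : (j < k)%N ->
    (\int[P]_w `|l j w0 - l j w|%:E <= (C * e)%:E)%E.
  move=> jk.
  have z_le : `|l j w0 - m| <= e.
    rewrite -(@ler_pXn2r _ 2) ?nnegrE ?(ltW e0)// real_normK ?num_real//.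
    exact: le_trans (sqr_le_deviation (lin _ _ jk)) dev0.
  apply: (@le_trans _ _
    (\int[P]_w ((2 * e)%:E + (e^-1 ^+ 7)%:E * (deviation w ^+ 4)%:E)%E)%E).
    apply: ge0_le_integral => //.
    - by apply/measurable_EFinP; apply: measurableT_comp => //; exact: measurable_funB.
    - apply: emeasurable_funD => //; apply/measurable_EFinP.
      apply: measurable_funM => //; apply: measurable_funX.
      exact: measurable_deviation.
    - move=> w _; rewrite -EFinM -EFinD lee_fin.
      have := abs_le _ _ (sqr_le_deviation (lin _ w jk)); rewrite -/m => lw.
      rewrite (_ : l j w0 - l j w = (l j w0 - m) - (l j w - m)); last by ring.
      rewrite (le_trans (ler_normB _ _))// (le_trans (lerD z_le lw))//.
      by rewrite addrA -mulr2n mulr_natl.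
  have mdev : measurable_fun setT (fun w => (deviation w ^+ 4)%:E).
    by apply/measurable_EFinP/measurable_funX; exact: measurable_deviation.
  have dev4 w : (0 <= (deviation w ^+ 4)%:E)%E.
    by rewrite lee_fin exprn_ge0// deviation_ge0.
  have e7 : 0 <= e^-1 ^+ 7 by rewrite exprn_ge0// invr_ge0 ltW.
  rewrite ge0_integralD//; last 3 first.
  - by move=> w _; rewrite lee_fin mulr_ge0// ltW.
  - by move=> w _; rewrite mule_ge0.
  - by apply/measurable_EFinP; apply: measurable_funM => //; exact/measurable_EFinP.
  rewrite ge0_integralZl//.
  rewrite integral_prob_cst.
  rewrite (_ : C * e = 2 * e + deviation_cst * e); last by rewrite /C mulrDl.
  rewrite (EFinD (2 * e)) leeD2l//.
  apply: (@le_trans _ _ ((e^-1 ^+ 7)%:E * (deviation_cst * n%:R^-1 ^+ 4)%:E)%E).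
    by rewrite lee_wpmul2l// deviation_moment.
  rewrite -EFinM lee_fin -e3 -exprM mulrCA ler_wpM2l ?deviation_cst_ge0//.
  (* n^(-4) = e^12 *)
  rewrite (_ : e^-1 ^+ 7 * e ^+ (3 * 4) = e ^+ 5); last by field; rewrite gt_eqF.
  by rewrite exprSr ler_piMl ?(ltW e0)// exprn_ile1// ltW.
rewrite (@le_trans _ _ ((k%:R^-1)%:E * \sum_(j < k) (C * e)%:E)%E)//.
  by rewrite lee_wpmul2l ?lee_fin ?invr_ge0// lee_sum// => j _; exact: int_le.
by rewrite sumEFin sumr_const card_ord -EFinM -(mulr_natl (C * e)) mulKf.
Qed.

End Deviation.

Theorem corollary3p6 (R : realType) (k : nat) (L : R) (hk : (1 <= k)%N)
    (hL : 0 < L) :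
  exists C : R, 0 < C /\
    forall (d : measure_display) (Omega : measurableType d)
      (P : probability Omega R)
      (A : forall n : nat, 'M[R[i]]_n)
      (U : forall n : nat, Omega -> 'M[R[i]]_n),
      (forall n : nat, (k <= n)%N -> A n \is hermsymmx) ->
      (forall (n : nat) (a : R[i]), (k <= n)%N -> eigenvalue (A n) a ->
         (- L)%:C <= a <= L%:C) ->
      (forall n : nat, (k <= n)%N -> haar_distributed P (U n)) ->
      let mu (n : nat) (w : Omega) :=
        spectral_measure (compression k (U n w) (A n)) in
      {ae P, forall w : Omega, \forall n \near \oo,
         (d1 (mu n w) (mean_measure P (mu n))
            <= (C * n%:R `^ (- (1 / 3)))%:E)%E}.
Proof.
have K0 := deviation_cst_ge0 k L.
exists (2 + deviation_cst k L); split; first by rewrite ltr_pwDl.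
move=> d Omega P A U Ah AL hU mu.
(* starting at k + 1, so that the predecessor of each index is positive, as the
   telescoping bound on the series requires *)
pose idx N := (N + k).+1.
have kidx N : (k <= idx N)%N by rewrite /idx -addSn leq_addl.
(* Y N w <= 1 means that the deviation is at most n^(-2/3), for n = idx N *)
pose Y N w := deviation k (U (idx N)) (A (idx N)) w ^+ 4 / cbrtV R (idx N) ^+ 8.
have e0 N : 0 < cbrtV R (idx N) by exact: cbrtV_gt0.
have dev4 N w : 0 <= deviation k (U (idx N)) (A (idx N)) w ^+ 4.
  by rewrite exprn_ge0// deviation_ge0.
have mdev N := measurable_deviation (kidx N) (Ah _ (kidx N)) (hU _ (kidx N)).
have : {ae P, forall w, \forall N \near \oo, Y N w <= 1}.
  apply: (@ae_eventually_le1 _ _ _ P Y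
    (fun N => deviation_cst k L * cbrtV R (idx N) ^+ 4) (deviation_cst k L * 3)).
  - by move=> N; apply: measurable_funM => //; apply: measurable_funX; exact: mdev.
  - by move=> N w; rewrite divr_ge0// exprn_ge0// ltW.
  - move=> N; under eq_integral do rewrite /Y mulrC EFinM.
    rewrite ge0_integralZl//; last 3 first.
    + by apply/measurable_EFinP/measurable_funX; exact: mdev.
    + by move=> w _; rewrite lee_fin.
    + by rewrite lee_fin invr_ge0 exprn_ge0// ltW.
    have := deviation_moment hk (kidx N) (Ah _ (kidx N))
      (fun a => AL _ a (kidx N)) (hU _ (kidx N)).
    rewrite -cbrtVX3 -exprM => devN.
    rewrite (@le_trans _ _ ((cbrtV R (idx N) ^+ 8)^-1%:E *
      (deviation_cst k L * cbrtV R (idx N) ^+ (3 * 4))%:E)%E)//.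
      by rewrite lee_wpmul2l// lee_fin invr_ge0 exprn_ge0// ltW.
    rewrite -EFinM lee_fin le_eqVlt; apply/orP; left; apply/eqP.
    by field; rewrite gt_eqF.
  - by move=> M; rewrite -mulr_sumr ler_wpM2l// sum_cbrtVX4_le.
apply: filterS => w [N0 _ HN0]; exists (idx N0) => // n /= n_ge.
have nE : n = idx (n - k.+1)%N.
  by rewrite /idx -addnS subnK// (leq_trans _ n_ge)// /idx ltnS leq_addl.
have := HN0 (n - k.+1)%N; rewrite /Y /= -nE => devn.
have kn : (k <= n)%N by rewrite nE.
have en : 0 < cbrtV R n by rewrite nE.
apply: (d1_spectral_measure_le hk kn (Ah _ kn) (fun a => AL _ a kn) (hU _ kn)).
rewrite -(@ler_pXn2r _ 4) ?nnegrE ?deviation_ge0 ?exprn_ge0 ?(ltW en)//.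
rewrite -exprM -[leRHS]mul1r -ler_pdivrMr ?exprn_gt0// devn//.
by rewrite -(leq_add2r k.+1) subnK ?addnS// (leq_trans _ n_ge)// /idx ltnS leq_addl.
Qed.
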